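(* Let $\beta\in(0,1]$ and consider the SAMBA process with learning-rate function $$\alpha(p)=\frac{\beta}{1-\log p}.$$ Then $(\mathbf p(t))_{t\in\mathbb Z_+}$ is a Markov chain, with probability $1$ we have $p_{a^\star}(t)\to1$ as $t\to\infty$, and for every $T\in\mathbb N$, $$\mathrm{Rg}(T)\le \frac{N}{2\beta\Delta}\big(\log(\beta\Delta T)\big)^2+Q+\Big\lceil \frac{e}{\beta\Delta}\Big\rceil,$$ where $Q:=\sum_{t=0}^\infty\mathbb P\big(p_{a^\star}(t)\le\frac12\big)$.
   Context: Bandit model: $\mathcal A$ is a finite set of arms, $N=|\mathcal A|$. For each arm $a$ and time $t\in\mathbb Z_+=\{0,1,2,\dots\}$, $R_a(t)\in\{0,1\}$ is a Bernoulli random variable with mean $r_a\in[0,1]$; all $R_a(t)$ are independent. There is a unique optimal arm $a^\star$ with $r^\star:=r_{a^\star}>r_a$ for all $a\ne a^\star$, and $\Delta:=r^\star-\max_{a\neq a^\star}r_a>0$. SAMBA process with learning-rate function $\alpha$: $\mathbf p(0)$ is a probability vector on $\mathcal A$ with all entries positive. At each time $t$, let $a_\star(t)$ be an arm maximizing $p_a(t)$ (ties broken uniformly at random) and $p_\star(t)=p_{a_\star(t)}(t)$. Exactly one arm is played at time $t$, arm $a$ with conditional probability $p_a(t)$ given the past (using independent randomization); $I_a(t)$ is the indicator that $a$ is played, $I_\star(t)=I_{a_\star(t)}(t)$, $R_\star(t)=R_{a_\star(t)}(t)$. For each $a\ne a_\star(t)$, $$p_a(t+1)=p_a(t)+\alpha(p_a(t))\,p_a(t)^2\Big[\frac{I_a(t)R_a(t)}{p_a(t)}-\frac{I_\star(t)R_\star(t)}{p_\star(t)}\Big],$$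 and $p_{a_\star(t)}(t+1)=1-\sum_{a\ne a_\star(t)}p_a(t+1)$. Regret: $\mathrm{Rg}(T)=r^\star T-\mathbb E\big[\sum_{t=0}^{T-1}\sum_{a\in\mathcal A}I_a(t)R_a(t)\big]$. *)

(* Defs.v *)
From HB Require Import structures.
From mathcomp Require Import all_boot all_order all_algebra.
From mathcomp Require Import all_classical all_reals all_analysis.
Set Implicit Arguments. Unset Strict Implicit. Unset Printing Implicit Defensive.
Import Order.TTheory GRing.Theory Num.Theory.
Local Open Scope ring_scope.
Local Open Scope classical_set_scope.

Section Samba.
Variables (R : realType) (A : finType).

Definition samba_alpha (beta : R) (p : R) : R := beta / (1 - ln p).

Definition argmax_set (q : A -> R) : {set A} :=
  [set c : A | [forall c' : A, q c' <= q c]].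

(* One-step observation at time t: (leader a_star(t), played arm, reward vector R_.(t)). *)
Definition obs := (A * A * (A -> bool))%type.

(* SAMBA update of the probability vector q, given leader b, played arm a and
   reward vector rho (only rho a and rho b actually matter). *)
Definition samba_step (alpha : R -> R) (q : A -> R) (o : obs) : A -> R :=
  let b := o.1.1 in let a := o.1.2 in let rho := o.2 in
  let upd c := q c + alpha (q c) * q c ^+ 2 *
      (((a == c)%:R * (rho c)%:R) / q c - ((a == b)%:R * (rho b)%:R) / q b) in
  fun c => if c == b then 1 - \sum_(c' | c' != b) upd c' else upd c.

Fixpoint samba_traj (alpha : R -> R) (p0 : A -> R) (h : nat -> obs) (t : nat)
  : A -> R :=
  if t is t'.+1 then samba_step alpha (samba_traj alpha p0 h t') (h t') else p0.

(* Conditional probability of one step, given the current vector q: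
   leader b uniform on the argmax set, arm a played with probability q a,
   rewards independent Bernoulli(r c). *)
Definition step_prob (r : A -> R) (q : A -> R) (o : obs) : R :=
  let b := o.1.1 in let a := o.1.2 in let rho := o.2 in
  ((b \in argmax_set q)%:R / #|argmax_set q|%:R) * q a *
  \prod_(c : A) (if rho c then r c else 1 - r c).

(* Gap Delta = r_star - max_{a <> a_star} r_a (rewards are >= 0, so 0 is a
   neutral element for the max). *)
Definition gap (r : A -> R) (astar : A) : R :=
  r astar - \big[Num.max/0]_(a | a != astar) r a.

Section Process.
Context {d : measure_display} {Omega : measurableType d}.
Variables (L I : nat -> Omega -> A) (Rw : A -> nat -> Omega -> bool).

Definition obs_at (w : Omega) (s : nat) : obs := (L s w, I s w, fun c => Rw c s w).

Definition samba_p (alpha : R -> R) (p0 : A -> R) (t : nat) (w : Omega) : A -> R :=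
  samba_traj alpha p0 (obs_at w) t.

Definition hist_event (t : nat) (h : nat -> obs) : set Omega :=
  [set w | forall s, (s < t)%N ->
     [/\ L s w = (h s).1.1, I s w = (h s).1.2 & forall c, Rw c s w = (h s).2 c]].

Definition total_reward (T : nat) (w : Omega) : R :=
  \sum_(t < T) \sum_(a : A) (I t w == a)%:R * (Rw a t w)%:R.
End Process.
End Samba.

(* Main.v *)
Require Import Defs.
From HB Require Import structures.
From mathcomp Require Import all_boot all_order all_algebra.
From mathcomp Require Import all_classical all_reals all_analysis.
From mathcomp Require Import measurable_realfun ring lra.
Set Implicit Arguments. Unset Strict Implicit. Unset Printing Implicit Defensive.
Import Order.TTheory GRing.Theory Num.Theory numFieldNormedType.Exports.
Local Open Scope ring_scope.
Local Open Scope classical_set_scope.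

(** Write [g y = y^2 / (1 - ln y)], [c = beta * Delta], [x = p_astar] and
    [D = 1 - x].  Whoever leads, [x] is a submartingale: its drift is
    [beta * (r_astar - r_b) * g x] when [b] leads and
    [beta * sum_(a != astar) (r_astar - r_a) * g (p_a)] when [astar] leads.

    Convergence.  The drift is bounded below on [eps <= x <= 1 - eps], so that
    set is visited finitely often (Borel-Cantelli).  Near [0] the learning rate
    is small enough for [1 / x] to be a supermartingale, so [x] cannot stay
    near [0]; and [x' >= 2 x - 1] when [x > 1/2], so [x] cannot jump back from
    near [1] to near [0].

    Regret.  Up to [Q] only the times with [x > 1/2] matter; then [astar] leads
    and by convexity of [g] the mean of [D / N] shrinks at least as much as
    under [psi y = y - c * g y].  The iterates of [psi] are concave and
    nondecreasing, so by backward induction on the horizon the expected sum of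
    [D] over those times is at most [N * sum_(k < T) psi^k (D_0 / N)], the times
    with [x <= 1/2] only delaying the recursion.  Finally [z = 1 / y] satisfies
    [z' ln z' >= z ln z + c], whence [psi^k y <= ln v / v] with [v = c (k + 1)]. *)

(** * The function [y^2 / (1 - ln y)] and its flow *)

Section LogQuadratic.
Variable R : realType.
Implicit Types y s u v z c : R.

Definition logsq y : R := y ^+ 2 / (1 - ln y).
(** The derivative of [logsq] at [y > 0], factored so that its value at [0] is the limit [0]. *)
Definition dlogsq y : R := y * (2 / (1 - ln y) + (1 - ln y) ^- 2).

Lemma ln_ge1BV u : 0 < u -> 1 - u^-1 <= ln u.
Proof.
move=> u0; have ui0 : 0 < u^-1 by rewrite invr_gt0.
have : ln (1 + (u^-1 - 1)) <= u^-1 - 1 by apply: le_ln1Dx; lra.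
rewrite (_ : 1 + _ = u^-1); last ring.
by rewrite lnV ?posrE//; lra.
Qed.

Lemma ln_leB1 u : 0 < u -> ln u <= u - 1.
Proof.
move=> u0; have : ln (1 + (u - 1)) <= u - 1 by apply: le_ln1Dx; lra.
by rewrite (_ : 1 + _ = u)//; ring.
Qed.

Lemma logsq0 : logsq 0 = 0.
Proof. by rewrite /logsq expr2 !mul0r. Qed.

Lemma logsq_ge0 y : y <= 1 -> 0 <= logsq y.
Proof.
move=> y1; rewrite divr_ge0// ?sqr_ge0//; have := ln_le0 y1; lra.
Qed.

Lemma logsq_gt0 y : 0 < y <= 1 -> 0 < logsq y.
Proof.
move=> /andP[y0 y1]; rewrite divr_gt0// ?exprn_gt0//; have := ln_le0 y1; lra.
Qed.

Lemma logsq_le y z : 0 < y -> y <= z -> z <= 1 -> logsq y <= logsq z.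
Proof.
move=> y0 yz z1; have lz := ln_le0 z1.
have lyz : ln y <= ln z by rewrite ler_ln ?posrE//; lra.
apply: ler_pM; rewrite ?sqr_ge0// ?invr_ge0; [lra|by rewrite ler_sqr ?nnegrE; lra|].
by rewrite lef_pV2 ?posrE; lra.
Qed.

Lemma dlogsq_ge0 s : 0 <= s <= 1 -> 0 <= dlogsq s.
Proof.
move=> /andP[s0 s1]; rewrite mulr_ge0// addr_ge0//.
  by rewrite divr_ge0//; have := ln_le0 s1; lra.
by rewrite invr_ge0 sqr_ge0.
Qed.

(** This says that the tangent of [logsq] at [s] is nonpositive at [0]. After division by [s ^+ 2]
    only powers of [(1 - ln s)^-1] remain. *)
Lemma logsq_le_mul_dlogsq s : 0 <= s <= 1 -> logsq s <= s * dlogsq s.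
Proof.
move=> /andP[s0 s1]; rewrite /logsq /dlogsq mulrA -expr2.
apply: ler_wpM2l; first exact: sqr_ge0.
have := ln_le0 s1; move: (ln s) => l l0.
have : 0 <= (1 - l)^-1 by rewrite invr_ge0; lra.
by rewrite -exprVn => h; have := sqr_ge0 ((1 - l)^-1); lra.
Qed.

Lemma dlogsq_le1 s : 0 <= s <= 2^-1 -> dlogsq s <= 1.
Proof.
move=> /andP[s0 s2]; rewrite /dlogsq.
have [->|sN0] := eqVneq s 0; first by rewrite mul0r.
have sp : 0 < s by rewrite lt_neqAle eq_sym sN0.
(* From [ln 2 >= 1/2]; then [l >= 3/2], which is enough for [(2 * l + 1) / 2 <= l ^+ 2]. *)
have l2 : 2^-1 <= - ln s.
  have : ln s <= ln 2^-1 by rewrite ler_ln ?posrE//; lra.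
  rewrite lnV ?posrE//; have := @ln_ge1BV 2 (ltr0n _ 2); lra.
set l := 1 - ln s; have l32 : 3 / 2 <= l by rewrite /l; lra.
have -> : s * (2 / l + l ^- 2) = s * (2 * l + 1) / l ^+ 2.
  by field; apply: lt0r_neq0; lra.
rewrite ler_pdivrMr ?exprn_gt0 ?mul1r//; last lra.
have : s * (2 * l + 1) <= 2^-1 * (2 * l + 1) by apply: ler_wpM2r => //; lra.
nra.
Qed.

(** Convexity of [logsq], without second derivatives. With [y = s * u], [m = 1 - ln s] and
    [ln u >= 1 - u^-1], the claim reduces to the nonnegativity of
    [(u - 1) ^+ 2 * (m ^+ 2 * u + m + 1) / u]. *)
Lemma logsq_tangent s y : 0 <= s <= 1 -> 0 <= y <= 1 ->
  logsq s + dlogsq s * (y - s) <= logsq y.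
Proof.
move=> /andP[s0 s1] /andP[y0 y1].
have [->|sN0] := eqVneq s 0.
  by rewrite logsq0 /dlogsq !mul0r addr0 logsq_ge0.
have sp : 0 < s by rewrite lt_neqAle eq_sym sN0.
have [->|yN0] := eqVneq y 0.
  have := @logsq_le_mul_dlogsq s; rewrite s0 s1 logsq0 => /(_ isT); lra.
have yp : 0 < y by rewrite lt_neqAle eq_sym yN0.
pose u := y / s; have up : 0 < u by rewrite divr_gt0.
have yE : y = s * u by rewrite /u mulrC divfK.
have := ln_le0 y1; rewrite /logsq /dlogsq yE lnM ?posrE//.
have := ln_le0 s1; have := ln_ge1BV up.
move: (ln s) (ln u) => ls lu hu hs hsu.
set m := 1 - ls; have m1 : 1 <= m by rewrite /m; lra.
have -> : 1 - (ls + lu) = m - lu by rewrite /m; lra.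
have k1 : 1 <= m - lu by rewrite /m; lra.
have -> : s ^+ 2 / m + s * (2 / m + m ^- 2) * (s * u - s) =
   s ^+ 2 * (((2 * m + 1) * u - (m + 1)) / m ^+ 2).
  by field; apply: lt0r_neq0; lra.
rewrite exprMn -(mulrA (s ^+ 2) (u ^+ 2)); apply: ler_wpM2l; first exact: sqr_ge0.
rewrite ler_pdivrMr ?exprn_gt0//; last lra.
rewrite mulrAC ler_pdivlMr; last lra.
(* The bound on [ln u] can be multiplied in only when this factor is positive; otherwise the
   left-hand side is already nonpositive. *)
have [h|h] := leP ((2 * m + 1) * u - (m + 1)) 0.
  apply: (@le_trans _ _ 0); first by rewrite mulr_le0_ge0; lra.
  by rewrite mulr_ge0// sqr_ge0.
apply: (@le_trans _ _ (((2 * m + 1) * u - (m + 1)) * (m - 1 + u^-1))).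
  by apply: ler_wpM2l; lra.
rewrite -subr_ge0.
have -> : u ^+ 2 * m ^+ 2 - ((2 * m + 1) * u - (m + 1)) * (m - 1 + u^-1) =
  (u - 1) ^+ 2 * (m ^+ 2 * u + m + 1) / u by field; apply: lt0r_neq0.
apply: divr_ge0 (ltW up); apply: mulr_ge0; first exact: sqr_ge0.
have m0 : 0 <= m := le_trans ler01 m1.
by rewrite addr_ge0// addr_ge0// mulr_ge0 ?sqr_ge0// ltW.
Qed.

End LogQuadratic.

(** * Iterating the discretised flow *)

Section ShrinkIteration.
Variables (R : realType) (c : R).
Hypothesis c01 : 0 < c <= 1.
Implicit Types y s u v z : R.

(** One explicit Euler step, of length [c], for [y' = - logsq y]. *)
Definition shrink y : R := y - c * logsq y.

Lemma shrink_itv y : 0 <= y <= 2^-1 -> 0 <= shrink y <= y.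
Proof.
move=> /andP[y0 y2]; rewrite /shrink.
have g0 : 0 <= logsq y by rewrite logsq_ge0//; lra.
have gy : logsq y <= y * dlogsq y by apply: logsq_le_mul_dlogsq; lra.
have d1 : dlogsq y <= 1 by apply: dlogsq_le1; rewrite y0.
have /andP[c0 c1] := c01.
have cg : c * logsq y <= 1 * logsq y by apply: ler_wpM2r.
have cg0 : 0 <= c * logsq y by rewrite mulr_ge0// ltW.
have yd : y * dlogsq y <= y * 1 by apply: ler_wpM2l.
lra.
Qed.

Lemma iter_shrink_itv k y : 0 <= y <= 2^-1 -> 0 <= iter k shrink y <= y.
Proof.
move=> yI; elim: k => [|k /andP[ih0 ih1]] /=; first by lra.
by have := @shrink_itv (iter k shrink y); lra.
Qed.

(* [F] has a nonnegative supergradient everywhere on [[0, 1/2]], i.e. it is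
   concave and nondecreasing there, in the form Jensen's inequality needs. *)
Definition supergradient (F : R -> R) := forall s, 0 <= s <= 2^-1 ->
  exists2 a, 0 <= a & forall y, 0 <= y <= 2^-1 -> F y <= F s + a * (y - s).

Lemma supergradient_shrink : supergradient shrink.
Proof.
move=> s sI; exists (1 - c * dlogsq s).
  have d0 : 0 <= dlogsq s by apply: dlogsq_ge0; lra.
  have d1 := dlogsq_le1 sI.
  have /andP[c0 c1] := c01.
  have : c * dlogsq s <= 1 * dlogsq s by apply: ler_wpM2r.
  lra.
move=> y yI; rewrite /shrink.
have : logsq s + dlogsq s * (y - s) <= logsq y by apply: logsq_tangent; lra.
have /andP[c0 c1] := c01.
move=> /(ler_wpM2l (ltW c0)); nra.
Qed.

(** Supergradients multiply under composition; the outer one being nonnegative lets the inner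
    inequality pass through. *)
Lemma supergradient_iter k : supergradient (iter k shrink).
Proof.
elim: k => [|k ih] s sI /=; first by exists 1 => // y _; lra.
have [a a0 ha] := ih s sI.
have wI y : 0 <= y <= 2^-1 -> 0 <= iter k shrink y <= 2^-1.
  by move=> yI; have := @iter_shrink_itv k y yI; lra.
have [b b0 hb] := supergradient_shrink (wI s sI).
exists (b * a); first exact: mulr_ge0.
move=> y yI; apply: le_trans (hb _ (wI y yI)) _.
rewrite lerD2l -mulrA; apply: ler_wpM2l => //.
by have := ha y yI; lra.
Qed.

Definition shrink_sum n y : R := \sum_(k < n) iter k shrink y.

Lemma shrink_sumS n y : shrink_sum n.+1 y = y + shrink_sum n (shrink y).
Proof.
rewrite /shrink_sum big_ord_recl /=; congr (_ + _); apply: eq_bigr => i _.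
by rewrite -iterS iterSr.
Qed.

Lemma shrink_sum_leS n y : 0 <= y <= 2^-1 -> shrink_sum n y <= shrink_sum n.+1 y.
Proof.
move=> yI; rewrite /shrink_sum big_ord_recr/= lerDl.
by have := @iter_shrink_itv n y yI; lra.
Qed.

Lemma supergradient_sum n : supergradient (shrink_sum n).
Proof.
move=> s sI; rewrite /shrink_sum; elim: n => [|n [a a0 ha]].
  by exists 0 => // y _; rewrite !big_ord0; lra.
have [b b0 hb] := supergradient_iter n sI.
exists (a + b); first exact: addr_ge0.
move=> y yI; rewrite !big_ord_recr /=; have := ha y yI; have := hb y yI; nra.
Qed.

(** Jensen with monotonicity built in: since [a >= 0], an upper bound [s] on the mean suffices. The
    range of [Y] is constrained only where the weight is nonzero, because SAMBA stays in the simplex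
    only along observations of nonzero weight. *)
Lemma supergradient_jensen (J : finType) (w Y : J -> R) (F : R -> R) s :
  supergradient F -> (forall j, 0 <= w j) -> \sum_j w j = 1 ->
  (forall j, w j != 0 -> 0 <= Y j <= 2^-1) -> 0 <= s <= 2^-1 ->
  \sum_j w j * Y j <= s -> \sum_j w j * F (Y j) <= F s.
Proof.
move=> sF w0 w1 YI sI wY; have [a a0 ha] := sF s sI.
apply: (@le_trans _ _ (\sum_j w j * (F s + a * (Y j - s)))).
  apply: ler_sum => j _; have [->|wj] := eqVneq (w j) 0; first by rewrite !mul0r.
  by apply: ler_wpM2l => //; exact/ha/YI.
have -> : \sum_j w j * (F s + a * (Y j - s)) =
    (\sum_j w j) * (F s - a * s) + a * \sum_j w j * Y j.
  rewrite mulr_suml mulr_sumr -big_split /=; apply: eq_bigr => j _; ring.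
by rewrite w1; nra.
Qed.

(* With [z = 1 / y] this is [z ln z], the first integral of the flow
   [y' = - logsq y]. *)
Definition zlnz y : R := - ln y / y.

Lemma shrink_gt0 y : 0 < y <= 2^-1 -> 0 < shrink y.
Proof.
move=> /andP[y0 y2]; rewrite /shrink /logsq.
have ly : ln y <= 0 by apply: ln_le0; lra.
have : y ^+ 2 / (1 - ln y) <= y ^+ 2.
  by rewrite ler_pdivrMr ?ler_peMr ?sqr_ge0//; lra.
have : 0 <= y ^+ 2 / (1 - ln y) by rewrite divr_ge0 ?sqr_ge0//; lra.
have /andP[c0 c1] := c01; move: (_ / _) => g; nra.
Qed.

(** With [w = shrink y], the increment of [zlnz] splits into [- ln y * (1 / w - 1 / y)] and
    [(ln y - ln w) / w]. The second is at least [1 / w - 1 / y], so the total is at least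
    [(1 - ln y) * (y - w) / (y * w)], and this is at least [c] because [w <= y]. *)
Lemma zlnz_shrink y : 0 < y <= 2^-1 -> zlnz y + c <= zlnz (shrink y).
Proof.
move=> yI; have w0 := shrink_gt0 yI; have /andP[y0 y2] := yI.
have ly : ln y <= 0 by apply: ln_le0; lra.
have := shrink_itv; move=> /(_ y) /(_ _)/andP[|_ wy]; first by lra.
have wE : shrink y = y - c * (y ^+ 2 / (1 - ln y)) by [].
move: (shrink y) w0 wy wE => w w0 wy wE.
have wy1 : 1 - w / y <= ln y - ln w.
  have := @ln_ge1BV R (y / w) (divr_gt0 y0 w0).
  by rewrite ln_div ?posrE// invf_div.
have d : (y - w) / (y * w) >= c / (1 - ln y).
  have -> : y - w = (c / (1 - ln y)) * y ^+ 2 by rewrite wE; ring.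
  have /andP[c0 c1] := c01.
  rewrite -mulrA ler_peMr ?divr_ge0//; [lra|lra|].
  by rewrite ler_pdivlMr ?mulr_gt0// mul1r expr2; apply: ler_wpM2l; lra.
have e1 : (1 - ln y) * ((y - w) / (y * w)) >= c.
  have -> : c = (1 - ln y) * (c / (1 - ln y)).
    by field; apply: lt0r_neq0; lra.
  by apply: ler_wpM2l; lra.
have e2 : (ln y - ln w) / w >= (1 - w / y) / w.
  by apply: ler_wpM2r => //; rewrite invr_ge0 ltW.
have e3 : (1 - w / y) / w = (y - w) / (y * w).
  by field; rewrite !lt0r_neq0.
rewrite /zlnz.
have -> : - ln w / w = - ln y / y - ln y * ((y - w) / (y * w)) + (ln y - ln w) / w.
  by field; rewrite !lt0r_neq0.
rewrite e3 in e2; lra.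
Qed.

Lemma iter_shrink_gt0 k y : 0 < y <= 2^-1 -> 0 < iter k shrink y <= 2^-1.
Proof.
move=> yI; elim: k => [//|k ih] /=; rewrite shrink_gt0//=.
by have := @shrink_itv (iter k shrink y); lra.
Qed.

Lemma zlnz_iter k y : 0 < y <= 2^-1 -> c * k.+1%:R <= zlnz (iter k shrink y).
Proof.
move=> yI; have /andP[y0 y2] := yI; elim: k => [|k ih] /=.
  (* The starting point already contributes one [c]: [- ln y >= 1/2 >= y] gives [zlnz y >= 1 >= c].
     Hence [k.+1] rather than [k]. *)
  have lny : 2^-1 <= - ln y.
    have : ln y <= ln 2^-1 by rewrite ler_ln ?posrE//; lra.
    rewrite lnV ?posrE//; have := @ln_ge1BV R 2 (ltr0n _ 2); lra.
  rewrite /zlnz ler_pdivlMr// mulr1.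
  have /andP[c0 c1] := c01; nra.
have := zlnz_shrink (iter_shrink_gt0 k yI).
by rewrite -(natr1 k.+1) mulrDr mulr1; lra.
Qed.

(** If [v * y > ln v >= 1], then [y > v^-1], so [- ln y < ln v < v * y], contradicting the
    hypothesis [v <= zlnz y]. *)
Lemma le_of_zlnz y v : 0 < y -> 1 <= ln v -> 0 < v -> v <= zlnz y -> y <= ln v / v.
Proof.
move=> y0 v1 v0; rewrite /zlnz ler_pdivlMr// => h.
rewrite ler_pdivlMr// mulrC leNgt; apply/negP => hn.
have : - ln v < ln y.
  rewrite -lnV ?posrE// ltr_ln ?posrE ?invr_gt0//.
  by rewrite invf_plt ?posrE//; rewrite -(@ltr_pM2r _ y)// mulVf ?lt0r_neq0//; lra.
lra.
Qed.

Lemma iter_shrink_le k y : 0 <= y <= 2^-1 -> expR 1 <= c * k.+1%:R ->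
  iter k shrink y <= ln (c * k.+1%:R) / (c * k.+1%:R).
Proof.
move=> yI ev; set v := c * k.+1%:R in ev *.
have v0 : 0 < v by apply: lt_le_trans ev; exact: expR_gt0.
have l1 : 1 <= ln v by rewrite -[leLHS](expRK 1) ler_ln ?posrE ?expR_gt0.
have [y0|yN0] := eqVneq y 0.
  have := @iter_shrink_itv k y yI; have : 0 <= ln v / v by rewrite divr_ge0; lra.
  lra.
have yI' : 0 < y <= 2^-1 by lra.
apply: le_of_zlnz => //; last exact: zlnz_iter.
by have := iter_shrink_gt0 k yI'; lra.
Qed.

Lemma ln_div_le u v : expR 1 <= u -> u <= v -> ln v / v <= ln u / u.
Proof.
move=> eu uv; have u0 : 0 < u by apply: lt_le_trans eu; exact: expR_gt0.
have l1 : 1 <= ln u by rewrite -[leLHS](expRK 1) ler_ln ?posrE ?expR_gt0.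
have v0 : 0 < v by lra.
have := @ln_leB1 R (v / u) (divr_gt0 v0 u0); rewrite ln_div ?posrE// => h.
rewrite ler_pdivrMr// mulrAC -mulrA.
have : 1 <= v / u by rewrite ler_pdivlMr// mul1r.
move: (v / u) h => t h t1; nra.
Qed.

(** Comparison of a sum with an integral: [ln x ^+ 2] is an antiderivative of [2 * (ln x / x)],
    which is nonincreasing from [expR 1] on. *)
Lemma ln_sqr_increment u v : expR 1 <= u -> u < v ->
  2 * (ln v / v) * (v - u) <= ln v ^+ 2 - ln u ^+ 2.
Proof.
move=> eu uv; have u0 : 0 < u by apply: lt_le_trans eu; exact: expR_gt0.
pose f (x : R) := ln x ^+ 2.
have df (x : R) : 0 < x -> is_derive x 1 f (2 * (ln x / x)).
  move=> x0; have := is_derive1_ln x0 => ?.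
  apply: is_derive_eq; rewrite /= /GRing.scale /=; ring.
have [x] : exists2 x : R, x \in `]u, v[%R &
    f v - f u = (2 * (ln x / x)) * (v - u).
  apply: (@MVT R f (fun x => 2 * (ln x / x))) => // [x|]; rewrite ?in_itv/=.
    by move=> /andP[ux _]; apply: df; lra.
  apply: derivable_within_continuous => x; rewrite in_itv/= => /andP[ux _].
  by have [] : is_derive x 1 f (2 * (ln x / x)) by apply: df; lra.
rewrite in_itv/= /f => /andP[ux xv] ->; apply: ler_wpM2r; first lra.
by apply: ler_wpM2l => //; apply: ln_div_le; lra.
Qed.

(** The first [m = ceil (e / c)] terms are at most [1] each after multiplication by [N]. From there
    on [c * k] is at least [e], and the logarithmic bounds telescope. *)
Lemma shrink_sum_le (N T : nat) y : 0 <= y <= 2^-1 -> N%:R * y <= 1 ->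
  N%:R * shrink_sum T y <=
  N%:R / (2 * c) * ln (c * T%:R) ^+ 2 + (Num.ceil (expR 1 / c))%:~R.
Proof.
move=> yI Ny; have /andP[c0 c1] := c01.
pose m := `|Num.ceil (expR 1 / c)|%N.
have e0 : 0 < expR 1 / c :> R by rewrite divr_gt0// expR_gt0.
have mE : (Num.ceil (expR 1 / c))%:~R = m%:R :> R.
  by rewrite /m natr_absz ger0_norm// ceil_ge0; lra.
have em : expR 1 <= c * m%:R.
  by rewrite mulrC -ler_pdivrMr// -mE ceil_ge.
have h0 n : 0 <= N%:R / (2 * c) * ln (c * n%:R) ^+ 2.
  by rewrite mulr_ge0 ?sqr_ge0 ?divr_ge0//; lra.
have small n : N%:R * shrink_sum n y <= n%:R.
  elim: n => [|n ih]; first by rewrite /shrink_sum big_ord0 mulr0.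
  rewrite /shrink_sum big_ord_recr/= mulrDr -natr1; apply: lerD => //.
  apply: le_trans Ny; apply: ler_wpM2l => //.
  by have := @iter_shrink_itv n y yI; lra.
rewrite mE; have [Tm|mT] := leqP T m.
  have : T%:R <= m%:R :> R by rewrite ler_nat.
  by have := small T; have := h0 T; lra.
(* Induction starts at [m], where the crude bound suffices because the squared logarithm is
   nonnegative. *)
rewrite -(subnKC (ltnW mT)); elim: (T - m)%N => [|n ih].
  by rewrite addn0; have := small m; have := h0 m; lra.
rewrite addnS; move: (m + n)%N ih (leq_addr n m) => k ih mk.
rewrite /shrink_sum big_ord_recr/= mulrDr.
have ek : expR 1 <= c * k%:R.
  by apply: le_trans em _; apply: ler_wpM2l; rewrite ?ler_nat//; lra.
have kS : c * k.+1%:R = c * k%:R + c by rewrite -natr1; ring.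
have i1 : iter k shrink y <= ln (c * k.+1%:R) / (c * k.+1%:R).
  by apply: iter_shrink_le => //; lra.
have i2 := @ln_sqr_increment (c * k%:R) (c * k.+1%:R) ek.
have {}i2 : 2 * (ln (c * k.+1%:R) / (c * k.+1%:R)) * (c * k.+1%:R - c * k%:R) <=
    ln (c * k.+1%:R) ^+ 2 - ln (c * k%:R) ^+ 2 by apply: i2; lra.
have i3 : iter k shrink y <= (ln (c * k.+1%:R) ^+ 2 - ln (c * k%:R) ^+ 2) / (2 * c).
  apply: le_trans i1 _; rewrite ler_pdivlMr; last lra.
  have {}kS : c * k.+1%:R - c * k%:R = c by lra.
  by rewrite kS in i2; move: (ln _ / _) i2 => w i2; lra.
have {i3} : N%:R * iter k shrink y <=
    N%:R * ((ln (c * k.+1%:R) ^+ 2 - ln (c * k%:R) ^+ 2) / (2 * c)).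
  exact: ler_wpM2l.
move: ih; rewrite /shrink_sum.
have -> : N%:R * ((ln (c * k.+1%:R) ^+ 2 - ln (c * k%:R) ^+ 2) / (2 * c)) =
  N%:R / (2 * c) * ln (c * k.+1%:R) ^+ 2 - N%:R / (2 * c) * ln (c * k%:R) ^+ 2.
  by field; lra.
lra.
Qed.

End ShrinkIteration.

(** * One step of SAMBA *)

Section OneStep.
Variables (R : realType) (A : finType) (r : A -> R) (astar : A) (beta : R).
Hypothesis r01 : forall a, 0 <= r a <= 1.
Hypothesis rstar : forall a, a != astar -> r a < r astar.
Hypothesis gap_gt0 : 0 < gap r astar.
Hypothesis beta01 : 0 < beta <= 1.
Implicit Types (q : A -> R) (a b c : A).

Local Notation alpha := (samba_alpha beta).
Local Notation Delta := (gap r astar).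
Local Notation N := (@GRing.natmul R 1%R #|A|).

(** The type [obs] with finite functions as reward vectors, so that one-step expectations are finite
    sums. *)
Definition fobs : finType := (A * A * {ffun A -> bool})%type.
Definition obs_of (o : fobs) : obs A := (o.1.1, o.1.2, fun c => o.2 c).
Definition stepw q (o : fobs) : R := step_prob r q (obs_of o).
Definition next q (o : fobs) : A -> R := samba_step alpha q (obs_of o).
Definition leadw q b : R := (b \in argmax_set q)%:R / #|argmax_set q|%:R.

Definition simplex q := (forall a, 0 < q a) /\ \sum_a q a = 1.

Lemma gap_le a : a != astar -> Delta <= r astar - r a.
Proof.
move=> ha; rewrite /gap lerD2l lerN2 (bigD1 a)//= le_max lexx//.
Qed.

Lemma gap_le1 : Delta <= 1.
Proof.
rewrite /gap lerBlDr.
have : 0 <= \big[Num.max/0]_(a | a != astar) r a.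
  by elim/big_ind: _ => // [x y x0 y0|a _]; [rewrite le_max x0|case/andP: (r01 a)].
by have /andP[_ ?] := r01 astar; lra.
Qed.

(** Independence: the sum of products is a product of sums, and every coordinate other than [a] sums
    to [1]. *)
Lemma sum_bernoulli_prod a (F : bool -> R) :
  \sum_(rho : {ffun A -> bool}) (\prod_c (if rho c then r c else 1 - r c)) * F (rho a)
  = r a * F true + (1 - r a) * F false.
Proof.
pose G c (y : bool) := (if y then r c else 1 - r c) * (if c == a then F y else 1).
have -> : \sum_(rho : {ffun A -> bool})
      (\prod_c (if rho c then r c else 1 - r c)) * F (rho a) =
    \sum_(rho : {ffun A -> bool}) \prod_c G c (rho c).
  apply: eq_bigr => rho _; rewrite /G big_split/=; congr (_ * _).
  rewrite (bigD1 a)//= eqxx big1 ?mulr1// => c /negbTE ->//.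
rewrite -bigA_distr_bigA (bigD1 a)//= [X in _ * X]big1 ?mulr1.
  by rewrite big_bool /G eqxx.
by move=> c /negbTE ca; rewrite big_bool /G ca /= !mulr1; ring.
Qed.

Lemma stepw_marginal q (F : A -> A -> bool -> R) :
  \sum_o stepw q o * F o.1.1 o.1.2 (o.2 o.1.2) =
  \sum_b leadw q b * \sum_a q a * (r a * F b a true + (1 - r a) * F b a false).
Proof.
transitivity (\sum_(ba : A * A) \sum_(rho : {ffun A -> bool})
    stepw q (ba, rho) * F ba.1 ba.2 (rho ba.2)).
  by rewrite [RHS]pair_bigA /=; apply: eq_bigr => -[[b a] rho] _.
transitivity (\sum_b \sum_a \sum_(rho : {ffun A -> bool})
    stepw q (b, a, rho) * F b a (rho a)).
  by rewrite [RHS]pair_bigA /=; apply: eq_bigr => -[b a] _.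
apply: eq_bigr => b _; rewrite mulr_sumr; apply: eq_bigr => a _.
rewrite -sum_bernoulli_prod !mulr_sumr; apply: eq_bigr => rho _.
by rewrite /stepw /step_prob /leadw /= !mulrA.
Qed.

Lemma argmax_neq0 q : (0 < #|argmax_set q|)%N.
Proof.
apply/card_gt0P; exists [arg max_(c > astar) q c]%O; rewrite inE.
by apply/forallP => c; case: arg_maxP => // b _; apply.
Qed.

Lemma leadw_ge0 q b : 0 <= leadw q b.
Proof. by rewrite /leadw divr_ge0. Qed.

Lemma leadw_sum q : \sum_b leadw q b = 1.
Proof.
rewrite /leadw -mulr_suml (_ : \sum_b _ = \sum_(b in argmax_set q) 1); last first.
  by rewrite [RHS]big_mkcond; apply: eq_bigr => b _; case: (b \in _).
rewrite sumr_const.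
by rewrite divff// pnatr_eq0 -lt0n argmax_neq0.
Qed.

Lemma leadw_max q b : leadw q b != 0 -> forall c, q c <= q b.
Proof.
rewrite /leadw; case: (boolP (b \in _)) => [|_]; last by rewrite mul0r eqxx.
by rewrite inE => /forallP.
Qed.

Lemma stepw_ge0 q o : simplex q -> 0 <= stepw q o.
Proof.
move=> [q0 _]; rewrite /stepw /step_prob /= mulr_ge0//.
  by apply: mulr_ge0; [exact: divr_ge0|exact/ltW/q0].
by apply: prodr_ge0 => c _; case: ifP => _; have := r01 c; lra.
Qed.

Lemma stepw_sum q : simplex q -> \sum_o stepw q o = 1.
Proof.
move=> [_ q1]; have := @stepw_marginal q (fun _ _ _ => 1).
under eq_bigr do rewrite mulr1; move=> ->.
under eq_bigr => b _.
  under eq_bigr => a _ do rewrite !mulr1 addrC subrK mulr1.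
  rewrite q1 mulr1; over.
exact: leadw_sum.
Qed.

Lemma stepw_lead q o : stepw q o != 0 -> forall c, q c <= q o.1.1.
Proof.
move=> h; apply: leadw_max; apply: contraNneq h.
by rewrite /stepw /step_prob /leadw /= => ->; rewrite !mul0r.
Qed.

(* [samba_step] with leader [b] and played arm [a] depends on the reward vector
   only through the reward [y] of [a]. *)
Definition upd q b a (y : bool) c : R :=
  q c + alpha (q c) * q c ^+ 2 * (((a == c)%:R * y%:R) / q c - ((a == b)%:R * y%:R) / q b).
Definition move_to q b a (y : bool) c : R :=
  if c == b then 1 - \sum_(c' | c' != b) upd q b a y c' else upd q b a y c.

Lemma nextE q o : next q o = move_to q o.1.1 o.1.2 (o.2 o.1.2).
Proof.
case: o => [[b a] rho]; apply/funext => c /=.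
have E c' : q c' + alpha (q c') * q c' ^+ 2 *
    (((a == c')%:R * (rho c')%:R) / q c' - ((a == b)%:R * (rho b)%:R) / q b) =
    upd q b a (rho a) c'.
  rewrite /upd; congr (_ + _ * (_ / _ - _ / _)).
    by case: eqVneq => [->|_]//; rewrite !mul0r.
  by case: eqVneq => [->|_]//; rewrite !mul0r.
rewrite /next /samba_step /move_to /=; case: ifP => _; last exact: E.
by congr (_ - _); apply: eq_bigr => c' _; exact: E.
Qed.

Lemma mean_next q (F : (A -> R) -> R) :
  \sum_o stepw q o * F (next q o) =
  \sum_b leadw q b *
    \sum_a q a * (r a * F (move_to q b a true) + (1 - r a) * F (move_to q b a false)).
Proof.
rewrite -(@stepw_marginal q (fun b a y => F (move_to q b a y))).
by apply: eq_bigr => o _; rewrite nextE.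
Qed.

Lemma simplex_compl q b : simplex q -> 1 - \sum_(c | c != b) q c = q b.
Proof. by move=> [_]; rewrite (bigD1 b)//= => <-; rewrite addrK. Qed.

Lemma move_to_false q b a : simplex q -> move_to q b a false = q.
Proof.
move=> qS; apply/funext => c; rewrite /move_to.
have E c' : upd q b a false c' = q c'.
  by rewrite /upd !mulr0 !mul0r subrr mulr0 addr0.
case: eqVneq => [->|_]; last exact: E.
by under eq_bigr do rewrite E; exact: simplex_compl.
Qed.

(** * Size of the learning rate and invariance of the simplex *)

Lemma alpha_itv y : 0 < y <= 1 -> 0 < alpha y <= 1.
Proof.
move=> /andP[y0 y1]; have := ln_le0 y1; have /andP[b0 b1] := beta01 => l0.
rewrite /samba_alpha divr_gt0//=; last by lra.
by rewrite ler_pdivrMr ?mul1r; lra.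
Qed.

Lemma alpha_lt1 y : 0 < y < 1 -> alpha y < 1.
Proof.
move=> yI; have /andP[y0 y1] := yI; have := ln_lt0 yI; have /andP[b0 b1] := beta01 => l0.
by rewrite /samba_alpha ltr_pdivrMr ?mul1r; lra.
Qed.

Lemma alpha_logsq y : alpha y * y ^+ 2 = beta * logsq y.
Proof. by rewrite /samba_alpha /logsq mulrAC -mulrA. Qed.

Lemma simplexD q a b : simplex q -> a != b -> q a + q b <= 1.
Proof.
move=> [q0 q1] ab; rewrite -q1 (bigD1 a)//= lerD2l (bigD1 b) 1?eq_sym//= lerDl.
by apply: sumr_ge0 => c _; exact/ltW/q0.
Qed.

Lemma simplex_le1 q a : simplex q -> q a <= 1.
Proof.
move=> [q0 q1]; rewrite -q1 (bigD1 a)//= lerDl.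
by apply: sumr_ge0 => c _; exact/ltW/q0.
Qed.

Lemma move_to_leader q b c : simplex q -> c != b ->
  move_to q b b true c = q c * (1 - alpha (q c) * (q c / q b)).
Proof.
move=> [q0 _] cb; rewrite /move_to (negbTE cb) /upd eqxx eq_sym (negbTE cb) /=.
by field; rewrite !lt0r_neq0 ?q0.
Qed.

Lemma move_to_played q b a : simplex q -> a != b ->
  move_to q b a true a = q a * (1 + alpha (q a)).
Proof.
move=> [q0 _] ab; rewrite /move_to (negbTE ab) /upd eqxx (negbTE ab) /=.
by field; rewrite !lt0r_neq0 ?q0.
Qed.

Lemma move_to_other q b a c : a != b -> c != b -> c != a ->
  move_to q b a true c = q c.
Proof.
move=> ab cb ca; rewrite /move_to (negbTE cb) /upd (negbTE ab) eq_sym (negbTE ca) /=.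
by rewrite !mul0r subrr mulr0 addr0.
Qed.

Lemma move_to_dethroned q b a : simplex q -> a != b ->
  move_to q b a true b = q b - alpha (q a) * q a.
Proof.
move=> qS ab; rewrite /move_to eqxx (bigD1 a)//=.
have -> : upd q b a true a = q a * (1 + alpha (q a)).
  by rewrite -(move_to_played qS ab) /move_to (negbTE ab).
have -> : \sum_(c | (c != b) && (c != a)) upd q b a true c =
    \sum_(c | (c != b) && (c != a)) q c.
  apply: eq_bigr => c /andP[cb ca].
  by rewrite -(move_to_other q ab cb ca) /move_to (negbTE cb).
have := simplex_compl b qS; rewrite (bigD1 a)//=; lra.
Qed.

Lemma move_to_sum q b a y : \sum_c move_to q b a y c = 1.
Proof.
rewrite (bigD1 b)//= (eq_bigr (upd q b a y)); last first.
  by move=> c /negbTE cb; rewrite /move_to cb.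
by rewrite /move_to eqxx subrK.
Qed.

Lemma leader_factor q b c : simplex q -> (forall c, q c <= q b) -> c != b ->
  0 < 1 - alpha (q c) * (q c / q b) <= 1.
Proof.
move=> qS qb cb; have [q0 _] := qS; have := simplexD qS cb => s1.
have qc1 : q c < 1 by have := q0 b; lra.
have t1 : q c / q b <= 1 by rewrite ler_pdivrMr ?mul1r.
have t0 : 0 < q c / q b by rewrite divr_gt0.
have al : 0 < alpha (q c) < 1.
  by rewrite alpha_lt1 ?q0// andbT; have := @alpha_itv (q c); rewrite q0 ltW//= => /(_ isT)/andP[].
by move: (alpha _) (q c / q b) al t0 t1 => x t; nra.
Qed.

(** Only positivity is at stake. A winning leader scales the others by positive factors at most [1]
    and collects the rest; a leader that yields to [a] loses [alpha (q a) * q a < q a <= q b]. *)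
Lemma move_to_simplex q b a y : simplex q -> (forall c, q c <= q b) ->
  simplex (move_to q b a y).
Proof.
move=> qS qb; split; last exact: move_to_sum.
case: y; last by rewrite move_to_false//; case: qS.
have [q0 q1] := qS; move=> c.
have [{a}->|ab] := eqVneq a b.
  have pos c' : c' != b -> 0 < move_to q b b true c'.
    move=> cb; rewrite move_to_leader// mulr_gt0//.
    by have := leader_factor qS qb cb; lra.
  have [->|cb] := eqVneq c b; last exact: pos.
  have := move_to_sum q b b true; rewrite (bigD1 b)//=.
  have : \sum_(i | i != b) move_to q b b true i <= \sum_(i | i != b) q i.
    apply: ler_sum => i ib; rewrite move_to_leader// ler_piMr//; first exact: ltW.
    by have := leader_factor qS qb ib; lra.
  by have := simplex_compl b qS; have := q0 b; lra.
have [->|cb] := eqVneq c b.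
  rewrite move_to_dethroned//.
  have := @alpha_lt1 (q a); have := simplexD qS ab; have := q0 a; have := q0 b.
  move=> b0 a0 ab1 /(_ _) h.
  have {}h : alpha (q a) < 1 by apply: h; lra.
  by have := qb a; nra.
have [->|ca] := eqVneq c a; last by rewrite move_to_other.
rewrite move_to_played// mulr_gt0//.
by have := @alpha_itv (q a); rewrite q0 simplex_le1// => /(_ isT); lra.
Qed.

Lemma next_simplex q o : simplex q -> stepw q o != 0 -> simplex (next q o).
Proof. by move=> qS /stepw_lead qb; rewrite nextE; exact: move_to_simplex. Qed.

(** A play without reward leaves [q] unchanged, so only rewarded plays enter the drift. A bound
    uniform over the possible leaders survives averaging over ties. *)
Lemma mean_next_le q (F : (A -> R) -> R) v : simplex q ->
  (forall b, (forall c, q c <= q b) ->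
     \sum_a q a * r a * (F (move_to q b a true) - F q) <= v) ->
  \sum_o stepw q o * F (next q o) <= F q + v.
Proof.
move=> qS h; rewrite mean_next.
have -> : F q + v = \sum_b leadw q b * (F q + v) by rewrite -mulr_suml leadw_sum mul1r.
apply: ler_sum => b _; have [->|lb] := eqVneq (leadw q b) 0; first by rewrite !mul0r.
apply: ler_wpM2l; first exact: leadw_ge0.
have -> : \sum_a q a * (r a * F (move_to q b a true) + (1 - r a) * F (move_to q b a false)) =
    (\sum_a q a) * F q + \sum_a q a * r a * (F (move_to q b a true) - F q).
  rewrite mulr_suml -big_split /=; apply: eq_bigr => a _.
  by rewrite move_to_false//; ring.
by rewrite qS.2 mul1r lerD2l; exact/h/leadw_max.
Qed.

Lemma mean_next_ge q (F : (A -> R) -> R) v : simplex q ->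
  (forall b, (forall c, q c <= q b) ->
     v <= \sum_a q a * r a * (F (move_to q b a true) - F q)) ->
  F q + v <= \sum_o stepw q o * F (next q o).
Proof.
move=> qS h; have := @mean_next_le q (fun p => - F p) (- v) qS.
rewrite (eq_bigr (fun o => - (stepw q o * F (next q o)))) => [|o _]; last by rewrite mulrN.
rewrite sumrN -opprD lerN2; apply => b qb.
rewrite (eq_bigr (fun a => - (q a * r a * (F (move_to q b a true) - F q)))) => [|a _]; last by ring.
by rewrite sumrN lerN2; exact: h.
Qed.

(** * Drift of the mass of [astar] *)

Lemma move_to_leader_self q b : simplex q -> move_to q b b true b =
  q b + \sum_(c | c != b) beta * logsq (q c) / q b.
Proof.
move=> qS; have := move_to_sum q b b true; rewrite (bigD1 b)//=.
rewrite (eq_bigr (fun c => q c - beta * logsq (q c) / q b)); last first.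
  move=> c cb; rewrite move_to_leader// -alpha_logsq.
  by field; rewrite lt0r_neq0//; case: qS.
by rewrite sumrB; have := simplex_compl b qS; lra.
Qed.

(** Only plays of [astar] and of the leader move [q astar]. The leader's loss term carries
    [1 / q b], which cancels against the probability [q b] of playing it. *)
Lemma drift_follower q b : simplex q -> b != astar ->
  \sum_a q a * r a * (move_to q b a true astar - q astar) =
  (r astar - r b) * (beta * logsq (q astar)).
Proof.
move=> qS ba; have [q0 _] := qS; rewrite (bigD1 astar)//= (bigD1 b)//= big1.
  rewrite move_to_leader 1?eq_sym// move_to_played 1?eq_sym// -alpha_logsq.
  by field; rewrite lt0r_neq0.
move=> a /andP[aa ab].
by rewrite move_to_other ?subrr ?mulr0// eq_sym.
Qed.

Lemma drift_leader q : simplex q ->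
  \sum_a q a * r a * (move_to q astar a true astar - q astar) =
  \sum_(a | a != astar) (r astar - r a) * (beta * logsq (q a)).
Proof.
move=> qS; have [q0 _] := qS; rewrite (bigD1 astar)//= move_to_leader_self//.
rewrite addrAC subrr add0r -mulr_suml.
have -> : q astar * r astar *
    ((\sum_(c | c != astar) beta * logsq (q c)) / q astar) =
    \sum_(c | c != astar) r astar * (beta * logsq (q c)).
  by rewrite -[RHS]mulr_sumr; field; rewrite lt0r_neq0.
rewrite -big_split /=; apply: eq_bigr => a aa.
by rewrite move_to_dethroned// -alpha_logsq; ring.
Qed.

Lemma card_gt0R : 0 < N.
Proof. by rewrite ltr0n; apply/card_gt0P; exists astar. Qed.

Lemma defect_sum q : simplex q -> 1 - q astar = \sum_(c | c != astar) q c.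
Proof. by move=> qS; have := simplex_compl astar qS; lra. Qed.

(** With two arms or more, [N >= 2]; with a single arm the defect vanishes. This keeps the argument
    in the range where [shrink] is monotone. *)
Lemma defect_itv q : simplex q -> 0 <= (1 - q astar) / N <= 2^-1.
Proof.
move=> qS; have := simplex_le1 astar qS => q1; have := card_gt0R => N0.
rewrite divr_ge0 ?subr_ge0//= ler_pdivrMr//.
have [/existsP[a aa]|/existsPn h] := boolP [exists a, a != astar].
  have : 2%:R <= N.
    by rewrite ler_nat (cardD1 astar) (cardD1 a) !inE aa.
  by have := qS.1 astar; lra.
rewrite defect_sum// big_pred0; first lra.
by move=> a; exact/negbTE/h.
Qed.

Lemma sum_suboptimal_const (x : R) : \sum_(a | a != astar) x = N * x - x.
Proof.
have : \sum_(a : A) x = N * x by rewrite sumr_const mulr_natl.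
by rewrite (bigD1 astar)//=; lra.
Qed.

(* Jensen over the suboptimal arms; averaging over [N] instead of [N - 1]
   terms is harmless because [logsq s <= s * dlogsq s]. *)
Lemma sum_logsq q : simplex q ->
  N * logsq ((1 - q astar) / N) <= \sum_(a | a != astar) logsq (q a).
Proof.
move=> qS; have N0 := card_gt0R; set s := (1 - q astar) / N.
have sI : 0 <= s <= 1 by have := defect_itv qS; rewrite -/s; lra.
have Ns : N * s = 1 - q astar by rewrite /s mulrC divfK// lt0r_neq0.
apply: (@le_trans _ _ (\sum_(a | a != astar) (logsq s + dlogsq s * (q a - s)))); last first.
  apply: ler_sum => a _; apply: logsq_tangent => //.
  by rewrite (ltW (qS.1 a)) simplex_le1.
have -> : \sum_(a | a != astar) (logsq s + dlogsq s * (q a - s)) =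
    \sum_(a | a != astar) logsq s +
    dlogsq s * (\sum_(a | a != astar) q a - \sum_(a | a != astar) s).
  by rewrite -sumrB mulr_sumr -big_split.
rewrite -(defect_sum qS) !sum_suboptimal_const -Ns.
by have := logsq_le_mul_dlogsq sI; lra.
Qed.

Lemma drift_leader_ge q : simplex q ->
  beta * Delta * (N * logsq ((1 - q astar) / N)) <=
  \sum_(a | a != astar) (r astar - r a) * (beta * logsq (q a)).
Proof.
move=> qS; have /andP[b0 b1] := beta01.
apply: (@le_trans _ _ (beta * Delta * \sum_(a | a != astar) logsq (q a))).
  by apply: ler_wpM2l; [rewrite mulr_ge0 ?ltW|exact: sum_logsq].
rewrite mulr_sumr; apply: ler_sum => a aa.
rewrite [leLHS](_ : _ = Delta * (beta * logsq (q a))); last ring.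
apply: ler_wpM2r; last exact: gap_le.
by rewrite mulr_ge0 ?logsq_ge0 ?simplex_le1// ltW.
Qed.

Lemma mean_star_ge q : simplex q ->
  q astar <= \sum_o stepw q o * next q o astar.
Proof.
move=> qS; have /andP[b0 b1] := beta01; have N0 := card_gt0R.
rewrite -[leLHS]addr0; apply: (@mean_next_ge q (fun p => p astar)) => // b qb.
have [->|ba] := eqVneq b astar.
  rewrite drift_leader//; apply: le_trans (drift_leader_ge qS).
  have g0 : 0 <= logsq ((1 - q astar) / N) by apply: logsq_ge0; have := defect_itv qS; lra.
  by apply: mulr_ge0; apply: mulr_ge0 => //; exact: ltW.
rewrite drift_follower// mulr_ge0//.
  by have := rstar ba; lra.
by rewrite mulr_ge0 ?logsq_ge0 ?simplex_le1// ltW.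
Qed.

(** The level [eps / N] lies below both [q astar] and the averaged defect, so one bound serves
    whichever arm leads. *)
Lemma mean_star_ge_mid q eps : simplex q -> 0 < eps -> eps <= q astar <= 1 - eps ->
  q astar + beta * Delta * logsq (eps / N) <= \sum_o stepw q o * next q o astar.
Proof.
move=> qS e0 qe; have /andP[b0 b1] := beta01; have N0 := card_gt0R.
have N1 : 1 <= N by rewrite -[leLHS]/(1%:R) ler_nat; apply/card_gt0P; exists astar.
have eN0 : 0 < eps / N by rewrite divr_gt0.
have eNe : eps / N <= eps by rewrite ler_pdivrMr// ler_peMr// ltW.
have q1 := simplex_le1 astar qS.
apply: (@mean_next_ge q (fun p => p astar)) => // b qb.
have [->|ba] := eqVneq b astar.
  rewrite drift_leader//; apply: le_trans (drift_leader_ge qS).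
  apply: ler_wpM2l; first by rewrite mulr_ge0 ?ltW.
  have d2 := defect_itv qS.
  have le1 : logsq (eps / N) <= logsq ((1 - q astar) / N).
    apply: logsq_le => //; last lra.
    by apply: ler_wpM2r; [rewrite invr_ge0 ltW|lra].
  apply: le_trans le1 _; rewrite ler_peMl// logsq_ge0//; lra.
rewrite drift_follower// [leLHS](_ : _ = Delta * (beta * logsq (eps / N))); last ring.
have g0 : 0 <= logsq (eps / N) by apply: logsq_ge0; lra.
have gl : logsq (eps / N) <= logsq (q astar) by apply: logsq_le => //; lra.
apply: ler_pM; [exact: ltW|by rewrite mulr_ge0// ltW|exact: gap_le|].
by apply: ler_wpM2l => //; exact: ltW.
Qed.

Lemma leader_star q b : simplex q -> 2^-1 < q astar -> (forall c, q c <= q b) -> b = astar.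
Proof.
move=> qS q2 qb; apply/eqP/negPn/negP => ba.
by have := simplexD qS ba; have := qb astar; lra.
Qed.

Lemma mean_defect q : simplex q -> \sum_o stepw q o * ((1 - next q o astar) / N) =
  (1 - \sum_o stepw q o * next q o astar) / N.
Proof.
move=> qS; transitivity ((\sum_o stepw q o - \sum_o stepw q o * next q o astar) / N).
  rewrite -sumrB mulr_suml.
  by apply: eq_bigr => o _; ring.
by rewrite stepw_sum.
Qed.

Lemma mean_defect_le q : simplex q ->
  \sum_o stepw q o * ((1 - next q o astar) / N) <= (1 - q astar) / N.
Proof.
move=> qS; rewrite mean_defect//; apply: ler_wpM2r; first by rewrite invr_ge0 ltW ?card_gt0R.
by have := mean_star_ge qS; lra.
Qed.

Lemma mean_defect_le_shrink q : simplex q -> 2^-1 < q astar ->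
  \sum_o stepw q o * ((1 - next q o astar) / N) <=
  shrink (beta * Delta) ((1 - q astar) / N).
Proof.
move=> qS q2; rewrite mean_defect// /shrink ler_pdivrMr ?card_gt0R//.
have N0 := card_gt0R.
have -> : ((1 - q astar) / N - beta * Delta * logsq ((1 - q astar) / N)) * N =
   1 - (q astar + beta * Delta * (N * logsq ((1 - q astar) / N))).
  by move: (logsq _) => g; field; rewrite lt0r_neq0.
rewrite lerD2l lerN2; apply: (@mean_next_ge q (fun p => p astar)) => // b qb.
by rewrite (leader_star qS q2 qb) drift_leader// drift_leader_ge.
Qed.

Lemma betaDelta_itv : 0 < beta * Delta <= 1.
Proof.
have /andP[b0 b1] := beta01; rewrite mulr_gt0//=.
by have := gap_le1; have := gap_gt0; nra.
Qed.

(** Dynamic programming inequality: [N * shrink_sum n] dominates the cost of the [n] remaining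
    steps, and Jensen carries the mean of the defect inside it. *)
Lemma regret_step q n : simplex q ->
  (if 2^-1 < q astar then 1 - q astar else 0) +
  \sum_o stepw q o * (N * shrink_sum (beta * Delta) n ((1 - next q o astar) / N)) <=
  N * shrink_sum (beta * Delta) n.+1 ((1 - q astar) / N).
Proof.
move=> qS; have N0 := card_gt0R; have dI := defect_itv qS.
have -> : \sum_o stepw q o * (N * shrink_sum (beta * Delta) n ((1 - next q o astar) / N)) =
   N * \sum_o stepw q o * shrink_sum (beta * Delta) n ((1 - next q o astar) / N).
  by rewrite mulr_sumr; apply: eq_bigr => o _; ring.
have J s : 0 <= s <= 2^-1 -> \sum_o stepw q o * ((1 - next q o astar) / N) <= s ->
    \sum_o stepw q o * shrink_sum (beta * Delta) n ((1 - next q o astar) / N) <=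
    shrink_sum (beta * Delta) n s.
  move=> sI; apply: (supergradient_jensen (supergradient_sum betaDelta_itv n)) => //.
  - by move=> o; exact: stepw_ge0.
  - exact: stepw_sum.
  - by move=> o wo; exact/defect_itv/next_simplex.
case: ifPn => [q2|_].
  rewrite shrink_sumS [leRHS]mulrDr (_ : N * ((1 - q astar) / N) = 1 - q astar); last first.
    by rewrite mulrC divfK// lt0r_neq0.
  rewrite lerD2l.
  apply: ler_wpM2l; first exact: ltW.
  apply: J; last exact: mean_defect_le_shrink.
  by have := shrink_itv betaDelta_itv dI; lra.
(* Here nothing is charged and the mean defect merely does not increase, so [n] of the [n.+1] terms
   suffice. *)
rewrite add0r; apply: ler_wpM2l; first exact: ltW.
apply: le_trans (shrink_sum_leS betaDelta_itv n dI).
by apply: J => //; exact: mean_defect_le.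
Qed.

(** * Behaviour near [0] and near [1] *)

Lemma alpha_small y : 0 < y <= expR (- (2 / Delta)) -> alpha y <= Delta / 2.
Proof.
move=> /andP[y0 ye]; have /andP[b0 b1] := beta01; have := gap_gt0 => D0.
have : ln y <= - (2 / Delta) by rewrite -[leRHS]expRK ler_ln ?posrE ?expR_gt0.
move=> ly; have t0 : 0 < 2 / Delta by rewrite divr_gt0.
rewrite /samba_alpha ler_pdivrMr; last lra.
have : 1 <= Delta / 2 * (1 - ln y).
  have E : Delta / 2 * (2 / Delta) = 1 by field; rewrite lt0r_neq0.
  by rewrite -[leLHS]E; apply: ler_wpM2l; lra.
lra.
Qed.

(** With [x = q astar] and [t = x / q b], the drift of [1 / x] is [al * (r b / (1 - al * t) - r
    astar / (1 + al))]. It is nonpositive once [r astar - r b >= al * (r b + r astar * t)], and the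
    right-hand side is at most [2 * al <= Delta]. *)
Lemma mean_inv_le q : simplex q -> q astar < N^-1 ->
  q astar <= expR (- (2 / Delta)) ->
  \sum_o stepw q o * (next q o astar)^-1 <= (q astar)^-1.
Proof.
move=> qS qN qe; have [q0 q1] := qS; have x0 := q0 astar.
rewrite -[leRHS]addr0; apply: (@mean_next_le q (fun p => (p astar)^-1)) => // b qb.
have ba : b != astar.
  (* A leader holds at least the average mass [N^-1]. *)
  apply: contraTneq qN => ba; rewrite -leNgt ba in qb *.
  rewrite -[leLHS]mul1r ler_pdivrMr ?card_gt0R// -[leLHS]q1 mulr_natr -sumr_const.
  exact: ler_sum.
rewrite (bigD1 astar)//= (bigD1 b)//= big1; last first.
  move=> a /andP[aa ab].
  by rewrite move_to_other ?subrr ?mulr0// eq_sym.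
rewrite move_to_leader 1?eq_sym// move_to_played 1?eq_sym// addr0.
have /andP[al0 _] : 0 < alpha (q astar) <= 1 by apply: alpha_itv; rewrite x0 simplex_le1.
have al1 : alpha (q astar) <= Delta / 2 by apply: alpha_small; rewrite x0.
have D1 := gap_le1; have Db := gap_le ba; have /andP[rb0 rb1] := r01 b.
have /andP[rs0 rs1] := r01 astar.
have t0 : 0 < q astar / q b by rewrite divr_gt0.
have t1 : q astar / q b <= 1 by rewrite ler_pdivrMr ?mul1r.
have yE : q b = q astar / (q astar / q b) by field; rewrite !lt0r_neq0.
move: (q b) (q astar) (q astar / q b) (alpha (q astar)) al0 al1 t0 t1 yE x0
  => y x t al al0 al1 t0 t1 yE x0.
have a1 : 0 < 1 - al * t by nra.
have -> : x * r astar * ((x * (1 + al))^-1 - x^-1) +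
    y * r b * ((x * (1 - al * t))^-1 - x^-1) =
    al * (r b / (1 - al * t) - r astar / (1 + al)).
  rewrite yE; field; rewrite !lt0r_neq0//; lra.
rewrite pmulr_rle0// subr_le0 ler_pdivrMr// mulrAC ler_pdivlMr; last lra.
have : al * t <= al by rewrite ler_piMr// ltW.
move: (al * t) => u ua; nra.
Qed.

Lemma next_star_ge q o : simplex q -> stepw q o != 0 -> 2^-1 < q astar ->
  2 * q astar - 1 <= next q o astar.
Proof.
move=> qS wo q2; have := stepw_lead wo; rewrite nextE => qb.
rewrite (leader_star qS q2 qb); have q1 := simplex_le1 astar qS.
case: (o.2 _); last by rewrite move_to_false//; lra.
have /andP[b0 b1] := beta01.
have [->|aa] := eqVneq o.1.2 astar.
  rewrite move_to_leader_self//.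
  have : 0 <= \sum_(c | c != astar) beta * logsq (q c) / q astar.
    apply: sumr_ge0 => c _; apply: divr_ge0; last exact/ltW/qS.1.
    by apply: mulr_ge0; [exact: ltW|exact/logsq_ge0/simplex_le1].
  lra.
rewrite move_to_dethroned//; have := simplexD qS aa; have a0 := qS.1 o.1.2.
have /andP[al0 al1] : 0 < alpha (q o.1.2) <= 1 by apply: alpha_itv; rewrite a0 simplex_le1.
nra.
Qed.

End OneStep.

(** * Expectations over finite histories *)

Section Histories.
Variables (R : realType) (A : finType) (r : A -> R) (astar : A) (beta : R) (p0 : A -> R).
Hypothesis r01 : forall a, 0 <= r a <= 1.
Hypothesis rstar : forall a, a != astar -> r a < r astar.
Hypothesis gap_gt0 : 0 < gap r astar.
Hypothesis beta01 : 0 < beta <= 1.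
Hypothesis p0S : simplex p0.
Implicit Types (l : seq (fobs A)) (phi f g : seq (fobs A) -> R).

Local Notation Delta := (gap r astar).
Local Notation N := (@GRing.natmul R 1%R #|A|).

(* Histories are listed with the most recent observation first. *)
Fixpoint traj l : A -> R := if l is o :: l' then next beta (traj l') o else p0.

(** Expectation over histories of length [t]. Each unfolding replaces [phi] by its conditional mean
    given the past, so martingale arguments become pointwise one-step inequalities. *)
Fixpoint Ex (t : nat) phi : R :=
  if t is t'.+1 then Ex t' (fun l => \sum_o stepw r (traj l) o * phi (o :: l))
  else phi [::].

Lemma eq_Ex t f g : (forall l, size l = t -> f l = g l) -> Ex t f = Ex t g.
Proof.
elim: t f g => [|t ih] f g fg /=; first exact: fg.
by apply: ih => l lt; apply: eq_bigr => o _; rewrite fg//= lt.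
Qed.

(** The comparison is needed only on histories that end in the simplex, since leaving it has weight
    zero. *)
Lemma le_Ex t f g : (forall l, size l = t -> simplex (traj l) -> f l <= g l) ->
  Ex t f <= Ex t g.
Proof.
elim: t f g => [|t ih] f g fg /=; first exact: fg.
apply: ih => l lt lS; apply: ler_sum => o _.
have [->|wo] := eqVneq (stepw r (traj l) o) 0; first by rewrite !mul0r.
apply: ler_wpM2l; first exact: stepw_ge0.
by apply: fg => /=; [rewrite lt|exact: (next_simplex beta01 lS wo)].
Qed.

Lemma eq_Ex_simplex t f g : (forall l, size l = t -> simplex (traj l) -> f l = g l) ->
  Ex t f = Ex t g.
Proof.
move=> fg; apply/eqP; rewrite eq_le; apply/andP; split;
  by apply: le_Ex => l lt lS; rewrite fg.
Qed.

Lemma ExD t f g : Ex t (fun l => f l + g l) = Ex t f + Ex t g.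
Proof.
elim: t f g => [//|t ih] f g /=; rewrite -ih; apply: eq_Ex => l _.
by rewrite -big_split/=; apply: eq_bigr => o _; rewrite mulrDr.
Qed.

Lemma ExZ t k f : Ex t (fun l => k * f l) = k * Ex t f.
Proof.
elim: t f => [//|t ih] f /=; rewrite -ih; apply: eq_Ex => l _.
by rewrite mulr_sumr; apply: eq_bigr => o _; rewrite mulrCA.
Qed.

Lemma Ex_cst t k : Ex t (fun=> k) = k.
Proof.
elim: t => [//|t ih] /=; rewrite -[RHS]ih; apply: eq_Ex_simplex => l _ lS.
by rewrite -mulr_suml stepw_sum// mul1r.
Qed.

Lemma ExB t f g : Ex t (fun l => f l - g l) = Ex t f - Ex t g.
Proof.
rewrite -[in RHS]mulN1r -ExZ -ExD; apply: eq_Ex => l _; by rewrite mulN1r.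
Qed.

Definition good_defect l : R :=
  if 2^-1 < traj l astar then 1 - traj l astar else 0.

(** Induction on the remaining horizon [n] for all starting times [t], with [regret_step] at each
    stage. *)
Lemma sum_good_defect n t :
  \sum_(s < n) Ex (t + s) good_defect <=
  Ex t (fun l => N * shrink_sum (beta * Delta) n ((1 - traj l astar) / N)).
Proof.
elim: n t => [|n ih] t.
  rewrite big_ord0 -[leLHS](Ex_cst t); apply: le_Ex => l _ _.
  by rewrite /shrink_sum big_ord0 mulr0.
rewrite big_ord_recl addn0.
have -> : \sum_(i < n) Ex (t + lift ord0 i) good_defect =
    \sum_(i < n) Ex (t.+1 + i) good_defect.
  by apply: eq_bigr => i _; rewrite addnS.
apply: le_trans (_ : Ex t good_defect + _ <= _); first exact: lerD (lexx _) (ih t.+1).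
rewrite /= -ExD; apply: le_Ex => l _ lS.
exact: regret_step.
Qed.

Lemma sum_good_defect_le T : \sum_(s < T) Ex s good_defect <=
  N / (2 * (beta * Delta)) * ln (beta * Delta * T%:R) ^+ 2 +
  (Num.ceil (expR 1 / (beta * Delta)))%:~R.
Proof.
apply: le_trans (sum_good_defect T 0) _ => /=.
apply: shrink_sum_le; first exact: betaDelta_itv.
  exact: defect_itv.
rewrite mulrC divfK; last by rewrite lt0r_neq0// card_gt0R.
by have := p0S.1 astar; lra.
Qed.

(** * Expected reward and regret over histories *)

Definition reward l : R :=
  if l is o :: _ then \sum_a (o.1.2 == a)%:R * (o.2 a)%:R else 0.

Lemma Ex_reward t : Ex t.+1 reward = Ex t (fun l => \sum_a traj l a * r a).
Proof.
rewrite [LHS]/=; apply: eq_Ex_simplex => l _ lS /=.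
have -> : \sum_a traj l a * r a = \sum_b leadw (traj l) b *
    \sum_a traj l a * (r a * true%:R + (1 - r a) * false%:R).
  rewrite -mulr_suml leadw_sum// mul1r; apply: eq_bigr => a _.
  by rewrite mulr1 mulr0 addr0.
rewrite -(@stepw_marginal R A r (traj l) (fun _ _ y => y%:R)).
apply: eq_bigr => o _; congr (_ * _).
rewrite (bigD1 o.1.2)//= eqxx mul1r big1 ?addr0// => a.
by rewrite eq_sym => /negbTE ->; rewrite mul0r.
Qed.

(** The instantaneous regret is at most the defect, as reward gaps are at most [1]. When [astar]
    holds at most half of the mass, the defect is bounded by [1] and charged to the indicator. *)
Lemma step_regret_le t : r astar - Ex t.+1 reward <=
  Ex t (fun l => (traj l astar <= 2^-1)%R%:R) + Ex t good_defect.
Proof.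
rewrite Ex_reward -{1}(Ex_cst t (r astar)) -ExB -ExD; apply: le_Ex => l _ lS.
have [q0 q1] := lS.
have : r astar - \sum_a traj l a * r a <= 1 - traj l astar.
  rewrite (defect_sum _ lS) -{1}[r astar]mulr1 -q1 mulr_sumr -sumrB (bigD1 astar)//=.
  rewrite mulrC subrr add0r; apply: ler_sum => a aa.
  rewrite mulrC -mulrBr ler_piMr//; first exact: ltW.
  by have := r01 a; have := r01 astar; lra.
rewrite /good_defect; have := q0 astar.
by case: (leP (traj l astar) 2^-1) => /= _; lra.
Qed.

Lemma regret_le T : r astar * T%:R - \sum_(t < T) Ex t.+1 reward <=
  \sum_(t < T) Ex t (fun l => (traj l astar <= 2^-1)%R%:R) +
  (N / (2 * (beta * Delta)) * ln (beta * Delta * T%:R) ^+ 2 +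
  (Num.ceil (expR 1 / (beta * Delta)))%:~R).
Proof.
apply: le_trans (lerD (lexx _) (sum_good_defect_le T)).
have -> : r astar * T%:R = \sum_(t < T) r astar.
  by rewrite sumr_const card_ord mulr_natr.
by rewrite -sumrB -big_split/=; apply: ler_sum => t _; exact: step_regret_le.
Qed.

(* When [astar] holds more than half of the mass, it cannot lose more than the
   total mass of the other arms in one step. *)
Definition regular l : bool :=
  if l is o :: l' then (traj l' astar <= 1) &&
    ((2^-1 < traj l' astar) ==> (2 * traj l' astar - 1 <= traj l astar))
  else true.

Lemma Ex_irregular t : Ex t (fun l => (~~ regular l)%:R) = 0.
Proof.
case: t => [//|t] /=; rewrite -[RHS](Ex_cst t); apply: eq_Ex_simplex => l _ lS.
apply: big1 => o _; rewrite simplex_le1//=.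
have [->|wo] := eqVneq (stepw r (traj l) o) 0; first by rewrite mul0r.
case: (ltP 2^-1 (traj l astar)) => [q2|_] /=; last by rewrite mulr0.
by rewrite (next_star_ge beta01 lS wo q2) mulr0.
Qed.

(** * Time spent at intermediate and at low mass *)

Definition mid (eps : R) l : bool := eps <= traj l astar <= 1 - eps.

(** The mean of [p_astar] never decreases, gains a fixed amount per expected visit, and stays at
    most [1]. *)
Lemma sum_mid_le eps n : 0 < eps ->
  beta * Delta * logsq (eps / N) * \sum_(t < n) Ex t (fun l => (mid eps l)%:R) <= 1.
Proof.
move=> e0; pose x l := traj l astar.
have : Ex 0 x + beta * Delta * logsq (eps / N) *
    \sum_(t < n) Ex t (fun l => (mid eps l)%:R) <= Ex n x.
  elim: n => [|n ih]; first by rewrite big_ord0 mulr0 addr0.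
  rewrite big_ord_recr/= mulrDr addrA.
  apply: le_trans (lerD ih (lexx _)) _.
  rewrite -ExZ -ExD /=; apply: le_Ex => l _ lS.
  case: (boolP (mid eps l)) => m /=.
    by rewrite mulr1; exact: mean_star_ge_mid.
  by rewrite mulr0 addr0; exact: mean_star_ge.
have : Ex n x <= 1.
  by rewrite -[leRHS](Ex_cst n); apply: le_Ex => l _ lS; exact: simplex_le1.
by have := p0S.1 astar; rewrite /= {2}/x /=; lra.
Qed.

(* Below this level [astar] is never the leader, and the learning rate is so
   small that [1 / p_astar] is a supermartingale. *)
Definition low : R := Num.min (expR (- (2 / Delta))) (N^-1 / 2).

Lemma low_gt0 : 0 < low.
Proof.
by rewrite /low lt_min expR_gt0 divr_gt0// invr_gt0 (card_gt0R R astar).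
Qed.

Lemma low_le2 : low <= 2^-1.
Proof.
rewrite /low ge_min; apply/orP; right.
have N1 : 1 <= N by rewrite -[leLHS]/(1%:R) ler_nat; apply/card_gt0P; exists astar.
have : N^-1 <= 1 by rewrite invf_le1//; lra.
lra.
Qed.

(** Constrains the times from [s] up to but excluding the current one, so the event is decided
    before the latest step. *)
Fixpoint low_since (s : nat) l : bool :=
  if l is o :: l' then low_since s l' && ((s <= size l')%N ==> (traj l' astar < low))
  else true.

(** The process [1 / p_astar], killed on leaving the low region, is a nonnegative
    supermartingale. *)
Lemma Ex_low_since_inv s n :
  Ex (s + n) (fun l => (low_since s l)%:R * (traj l astar)^-1) <=
  Ex s (fun l => (traj l astar)^-1).
Proof.
elim: n => [|n ih].
  rewrite addn0; apply: le_Ex => l _ lS; rewrite ler_piMl//.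
    by rewrite invr_ge0; exact/ltW/lS.1.
  by rewrite lern1 leq_b1.
rewrite addnS /=; apply: le_trans ih; apply: le_Ex => l lt lS.
rewrite lt leq_addr /=.
have [xl|xl] := ltP (traj l astar) low; last first.
  rewrite andbF big1 ?mulr_ge0 ?invr_ge0//; first exact/ltW/lS.1.
  by move=> o _; rewrite mul0r mulr0.
rewrite andbT.
have -> : \sum_o stepw r (traj l) o * ((low_since s l)%:R * (next beta (traj l) o astar)^-1) =
    (low_since s l)%:R * \sum_o stepw r (traj l) o * (next beta (traj l) o astar)^-1.
  by rewrite mulr_sumr; apply: eq_bigr => o _; rewrite mulrCA.
apply: ler_wpM2l => //; move: xl; rewrite /low lt_min => /andP[xe xN].
apply: mean_inv_le => //; last exact: ltW.
have : 0 < N^-1 by rewrite invr_gt0 (card_gt0R R astar).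
lra.
Qed.

(** Markov's inequality for [1 / p_astar] handles mass below [delta]; mass between [delta] and
    [low <= 1/2 <= 1 - delta] is intermediate. *)
Lemma Ex_stay_low s n delta : 0 < delta <= 2^-1 ->
  Ex (s + n) (fun l => (low_since s l && (traj l astar < low))%:R) <=
  delta * Ex s (fun l => (traj l astar)^-1) + Ex (s + n) (fun l => (mid delta l)%:R).
Proof.
move=> /andP[d0 d2].
apply: (@le_trans _ _ (delta * Ex (s + n) (fun l => (low_since s l)%:R * (traj l astar)^-1) +
   Ex (s + n) (fun l => (mid delta l)%:R))).
  rewrite -ExZ -ExD; apply: le_Ex => l _ lS.
  have x0 := lS.1 astar.
  have [|_] := boolP (low_since s l); last by rewrite /= mul0r mulr0 add0r.
  have [xl _|_ _] := ltP (traj l astar) low; last first.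
    by rewrite /= mul1r addr_ge0// mulr_ge0 ?invr_ge0// ltW.
  rewrite /= mul1r; have [dx|xd] := leP delta (traj l astar).
    have -> : mid delta l by rewrite /mid dx; have := low_le2; lra.
    by rewrite lerDr mulr_ge0 ?invr_ge0// ltW.
  have : 1 <= delta / traj l astar by rewrite ler_pdivlMr ?mul1r// ltW.
  by have : 0 <= (mid delta l)%:R :> R by []; lra.
rewrite lerD2r; apply: ler_wpM2l; [exact: ltW|exact: Ex_low_since_inv].
Qed.

End Histories.

(** * The process on the probability space *)

Section Past.
Variable T : Type.
Implicit Types h : nat -> T.

Fixpoint past h (t : nat) : seq T := if t is t'.+1 then h t' :: past h t' else [::].

Lemma size_past h t : size (past h t) = t.
Proof. by elim: t => //= t ->. Qed.

Lemma eq_past h h' t : (forall s, (s < t)%N -> h s = h' s) <-> past h t = past h' t.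
Proof.
elim: t => [|t ih]; first by split.
split=> [hh|/= [ht /ih hh] s]; last by rewrite ltnS leq_eqVlt => /orP[/eqP->//|/hh].
by rewrite /= hh//; congr cons; apply/ih => s st; exact/hh/ltnW.
Qed.

Lemma past_surj (x : T) (l : seq T) : exists h, past h (size l) = l.
Proof.
elim: l => [|o l [h hl]]; first by exists (fun=> x).
exists (fun s => if s == size l then o else h s) => /=; rewrite eqxx; congr cons.
rewrite -[RHS]hl; apply/eq_past => s sl.
by rewrite ltn_eqF.
Qed.

End Past.

Section Process.
Variables (R : realType) (A : finType) (d : measure_display)
  (Omega : measurableType d) (P : probability Omega R)
  (r : A -> R) (astar : A) (p0 : A -> R) (beta : R)
  (L I : nat -> Omega -> A) (Rw : A -> nat -> Omega -> bool).
Hypothesis mL : forall t a, measurable [set w | L t w = a].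
Hypothesis mI : forall t a, measurable [set w | I t w = a].
Hypothesis mR : forall a t, measurable [set w | Rw a t w].
Hypothesis law : forall (t : nat) (h : nat -> obs A),
  P (hist_event L I Rw t.+1 h) =
  (P (hist_event L I Rw t h) *
   (step_prob r (samba_traj (samba_alpha beta) p0 h t) (h t))%:E)%E.

Local Notation p := (samba_p L I Rw (samba_alpha beta) p0).
Local Notation E := (Ex r beta p0).
Local Notation traj := (traj beta p0).

(** * The random history and its law *)

Definition fobs_at w s : fobs A := (L s w, I s w, [ffun c => Rw c s w]).
Definition X t w : seq (fobs A) := past (fobs_at w) t.

Lemma size_X t w : size (X t w) = t.
Proof. exact: size_past. Qed.

Lemma fobs_atP w s (o : fobs A) :
  [/\ L s w = o.1.1, I s w = o.1.2 & forall c, Rw c s w = o.2 c] <-> fobs_at w s = o.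
Proof.
split=> [[h1 h2 h3]|<-]; last by split=> //= c; rewrite ffunE.
rewrite /fobs_at h1 h2 (_ : finfun _ = o.2); first by case: o {h1 h2 h3} => [[]].
by apply/ffunP => c; rewrite ffunE h3.
Qed.

Lemma samba_traj_past (h : nat -> fobs A) t :
  samba_traj (samba_alpha beta) p0 (fun s => obs_of (h s)) t = traj (past h t).
Proof. by elim: t => //= t ->. Qed.

Lemma samba_pE t w : p t w = traj (X t w).
Proof.
rewrite -samba_traj_past /samba_p; congr samba_traj.
by apply/funext => s; congr (_, _); apply/funext => c; rewrite ffunE.
Qed.

Lemma hist_eventE t (h : nat -> fobs A) :
  hist_event L I Rw t (fun s => obs_of (h s)) = [set w | X t w = past h t].
Proof.
apply/seteqP; split=> w /=.
  by move=> hw; apply/eq_past => s /hw/fobs_atP.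
by move=> /eq_past hw s /hw/fobs_atP.
Qed.

Fixpoint mass (l : seq (fobs A)) : R :=
  if l is o :: l' then mass l' * stepw r (traj l') o else 1.

(** Chain rule: the hypothesis [law] is multiplied along the history. *)
Lemma prob_X (l : seq (fobs A)) : P [set w | X (size l) w = l] = (mass l)%:E.
Proof.
have [h <-] := @past_surj (fobs A) (astar, astar, [ffun=> true]) l.
rewrite size_past -hist_eventE; elim: (size l) => [|t ih].
  by rewrite /= (_ : hist_event _ _ _ _ _ = setT) ?probability_setT//; apply/seteqP; split.
by rewrite law ih samba_traj_past -EFinM.
Qed.

Fixpoint hists (t : nat) : seq (seq (fobs A)) :=
  if t is t'.+1 then [seq o :: l | l <- hists t', o <- enum (fobs A)] else [:: [::]].

Lemma size_hists t l : l \in hists t -> size l = t.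
Proof.
elim: t l => [|t ih] l /=; first by rewrite inE => /eqP ->.
by move=> /allpairsP[[l' o] /= [/ih <- _ ->]].
Qed.

Lemma sum_hists t (phi : seq (fobs A) -> R) w :
  phi (X t w) = \sum_(l <- hists t) phi l * (X t w == l)%:R.
Proof.
elim: t phi => [|t ih] phi /=; first by rewrite big_seq1 eqxx mulr1.
rewrite big_allpairs_dep (ih (fun l => phi (fobs_at w t :: l))); apply: eq_bigr => l _.
rewrite big_enum/= (bigD1 (fobs_at w t))//= big1 => [|o].
  by rewrite eqseq_cons eqxx addr0.
by rewrite eqseq_cons eq_sym => /negbTE ->; rewrite mulr0.
Qed.

Lemma Ex_hists t (phi : seq (fobs A) -> R) : E t phi = \sum_(l <- hists t) mass l * phi l.
Proof.
elim: t phi => [|t ih] phi /=; first by rewrite big_seq1 mul1r.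
rewrite big_allpairs_dep ih; apply: eq_bigr => l _.
by rewrite big_enum mulr_sumr; apply: eq_bigr => o _; rewrite mulrA.
Qed.

Lemma measurable_fobs_at s o : measurable [set w | fobs_at w s = o].
Proof.
rewrite (_ : [set w | _] = [set w | L s w = o.1.1] `&` [set w | I s w = o.1.2] `&`
    \bigcap_(c in [set: A]) [set w | Rw c s w = o.2 c]); last first.
  apply/seteqP; split=> w /=.
    by move=> /fobs_atP[h1 h2 h3]; split=> // c _; exact: h3.
  by move=> [[h1 h2] h3]; apply/fobs_atP; split=> // c; exact: h3.
apply: measurableI; first exact: measurableI.
apply: fin_bigcap_measurable => // c _; case: (o.2 c); first exact: mR.
rewrite (_ : [set w | _] = ~` [set w | Rw c s w]); first exact/measurableC/mR.
by apply/seteqP; split=> w /=; [move=> ->|move/negP/negbTE].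
Qed.

Lemma measurable_X t (B : set (seq (fobs A))) : measurable [set w | B (X t w)].
Proof.
elim: t B => [|t ih] B.
  have [B0|B0] := pselect (B [::]).
    by rewrite (_ : [set w | _] = setT)//; apply/seteqP; split.
  by rewrite (_ : [set w | _] = set0)//; apply/seteqP; split.
rewrite (_ : [set w | _] = \bigcup_(o in [set: fobs A])
    ([set w | fobs_at w t = o] `&` [set w | B (o :: X t w)])); last first.
  apply/seteqP; split=> w /=; first by move=> Bw; exists (fobs_at w t).
  by move=> [x _ [] <-].
apply: fin_bigcup_measurable => // o _.
by apply: measurableI; [exact: measurable_fobs_at|exact: (ih (fun l => B (o :: l)))].
Qed.

Lemma measurable_fun_X t (phi : seq (fobs A) -> R) :
  measurable_fun [set: Omega] (fun w => phi (X t w)).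
Proof.
by move=> _ Y mY; rewrite setTI; exact: (@measurable_X t (fun l => Y (phi l))).
Qed.

(** [X t] takes its values in the finite list [hists t], so the integrand is a finite combination of
    indicators weighted by [mass]. *)
Lemma integral_X t (phi : seq (fobs A) -> R) : (forall l, 0 <= phi l) ->
  (\int[P]_w (phi (X t w))%:E = (E t phi)%:E)%E.
Proof.
move=> phi0.
under eq_integral => w _ do rewrite sum_hists -sumEFin.
rewrite ge0_integral_sum//; last 2 first.
- move=> l; apply/measurable_EFinP; exact: (@measurable_fun_X t (fun l' => phi l * (l' == l)%:R)).
- by move=> l w _; rewrite lee_fin mulr_ge0.
rewrite Ex_hists -sumEFin big_seq [RHS]big_seq; apply: eq_bigr => l lt.
rewrite -(size_hists lt).
transitivity (\int[P]_w ((phi l)%:E * (\1_[set w | X (size l) w = l] w)%:E))%E.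
  apply: eq_integral => w _; rewrite -EFinM indicE.
  rewrite (_ : (w \in _) = (X (size l) w == l))//.
  by apply/idP/eqP; rewrite inE.
have mS : measurable [set w | X (size l) w = l] by exact: (@measurable_X _ [set l]).
rewrite ge0_integralZl//.
- by rewrite integral_indic// setIT; rewrite [X in (_ * X)%E](prob_X l) -EFinM mulrC.
- exact/measurable_EFinP/measurable_indic.
- by rewrite lee_fin.
Qed.

Lemma prob_pred_X t (B : pred (seq (fobs A))) :
  P [set w | B (X t w)] = (E t (fun l => (B l)%:R))%:E.
Proof.
rewrite -integral_X//.
rewrite -[X in P X]setIT -integral_indic//; last exact: (@measurable_X t (fun l => B l)).
apply: eq_integral => w _; rewrite indicE (_ : (w \in _) = B (X t w))//.
by apply/idP/idP => [|Bw]; rewrite inE.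
Qed.

Lemma integral_total_reward T :
  (\int[P]_w (total_reward R I Rw T w)%:E = (\sum_(t < T) E t.+1 (@reward R A))%:E)%E.
Proof.
have rw0 (l : seq (fobs A)) : 0 <= reward R l.
  by case: l => [|o l] //=; apply: sumr_ge0 => a _; rewrite mulr_ge0.
transitivity (\int[P]_w \sum_(t < T) (reward R (X t.+1 w))%:E)%E.
  apply: eq_integral => w _; rewrite sumEFin; congr _%:E; apply: eq_bigr => t _ /=.
  by apply: eq_bigr => a _; rewrite ffunE.
rewrite ge0_integral_sum//; last 2 first.
- by move=> t; apply/measurable_EFinP; exact: measurable_fun_X.
- by move=> t w _; rewrite lee_fin.
by rewrite -sumEFin; apply: eq_bigr => t _; rewrite integral_X.
Qed.

(** * The Markov property *)

Definition kernel (q q' : A -> R) : R :=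
  \sum_o stepw r q o * (`[< next beta q o = q' >])%:R.

(** Any event of the past that fixes the current state [q] yields the same factor [kernel q q']. It
    is applied both to the whole trajectory and to the current state alone. *)
Lemma Ex_kernel t (B : pred (seq (fobs A))) f q q' :
  (forall l, size l = t -> B l -> traj l = q) ->
  (forall o l, size l = t -> f (o :: l) = (B l && `[< next beta (traj l) o = q' >])%:R) ->
  E t.+1 f = kernel q q' * E t (fun l => (B l)%:R).
Proof.
move=> Bq fE; rewrite -ExZ /=; apply: eq_Ex => l lt.
have [Bl|Bl] := boolP (B l).
  rewrite mulr1 /kernel -(Bq l lt Bl); apply: eq_bigr => o _.
  by rewrite fE// Bl.
by rewrite mulr0; apply: big1 => o _; rewrite fE// (negbTE Bl) mulr0.
Qed.

Fixpoint visits (x : nat -> A -> R) (l : seq (fobs A)) : bool :=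
  (if l is _ :: l' then visits x l' else true) && `[< traj l = x (size l) >].

Lemma visitsP x t w : (forall s, (s <= t)%N -> p s w = x s) <-> visits x (X t w).
Proof.
elim: t => [|t ih].
  split=> [/(_ 0%N (leqnn _)) h|/asboolP h s]; first exact/asboolP.
  by rewrite leqn0 => /eqP ->.
have -> : visits x (X t.+1 w) = visits x (X t w) && `[< p t.+1 w = x t.+1 >].
  transitivity (visits x (X t w) && `[< traj (X t.+1 w) = x (size (X t.+1 w)) >]) => //.
  by rewrite size_X samba_pE.
split=> [h|].
  apply/andP; split; first by apply/ih => s st; exact/h/leqW.
  by apply/asboolP; exact: h.
by move=> /andP[/ih h /asboolP h' s]; rewrite leq_eqVlt => /orP[/eqP ->|/h].
Qed.

(** Both sides equal the kernel times the same two probabilities. The product form makes sense for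
    conditioning events of probability zero. *)
Lemma markov_property t (x : nat -> A -> R) :
  (P ([set w | forall s, (s <= t.+1)%N -> p s w = x s]) *
   P ([set w | p t w = x t]))%E =
  (P ([set w | forall s, (s <= t)%N -> p s w = x s]) *
   P ([set w | p t w = x t /\ p t.+1 w = x t.+1]))%E.
Proof.
have vE s : [set w | forall u, (u <= s)%N -> p u w = x u] = [set w | visits x (X s w)].
  by apply/seteqP; split=> w /= /visitsP.
pose at_x l := `[< traj l = x t >].
pose two l := if l is _ :: l' then at_x l' && `[< traj l = x t.+1 >] else false.
have -> : [set w | p t w = x t] = [set w | at_x (X t w)].
  by apply/seteqP; split=> w /=; rewrite samba_pE => /asboolP.
have -> : [set w | p t w = x t /\ p t.+1 w = x t.+1] = [set w | two (X t.+1 w)].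
  apply/seteqP; split=> w /=; rewrite !samba_pE.
    by move=> [h1 h2]; apply/andP; split; apply/asboolP.
  by move=> /andP[/asboolP h1 /asboolP h2].
rewrite !vE !prob_pred_X.
rewrite (@Ex_kernel t (visits x) _ (x t) (x t.+1)); last 2 first.
- by move=> [|o l] <- /andP[_ /asboolP].
- by move=> o l <-.
rewrite (@Ex_kernel t at_x (fun l => (two l)%:R) (x t) (x t.+1)); last 2 first.
- by move=> l _ /asboolP.
- by [].
by rewrite -!EFinM; congr _%:E; ring.
Qed.

Hypothesis r01 : forall a, 0 <= r a <= 1.
Hypothesis rstar : forall a, a != astar -> r a < r astar.
Hypothesis gap_gt0 : 0 < gap r astar.
Hypothesis beta01 : 0 < beta <= 1.
Hypothesis p0S : simplex p0.

Lemma regret_bound T :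
  ((r astar * T%:R)%:E - \int[P]_w (total_reward R I Rw T w)%:E <=
   (#|A|%:R / (2 * beta * gap r astar) * (ln (beta * gap r astar * T%:R)) ^+ 2)%:E
   + (\sum_(0 <= t <oo) P [set w | (p t w astar <= 2^-1)%R])
   + ((Num.ceil (expR 1 / (beta * gap r astar)))%:~R)%:E)%E.
Proof.
have pE t : P [set w | (p t w astar <= 2^-1)%R] =
    (E t (fun l => (traj l astar <= 2^-1)%R%:R))%:E.
  rewrite -(prob_pred_X t (fun l => traj l astar <= 2^-1)).
  by congr (P _); apply/seteqP; split=> w /=; rewrite samba_pE.
rewrite integral_total_reward -EFinB addeAC -EFinD.
(* The partial sum up to [T] is below the full series, which may be infinite. *)
apply: le_trans (leeD (lexx _) (@nneseries_lim_ge R _ xpredT 0 T _)); last by move=> *; exact: measure_ge0.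
rewrite big_mkord (eq_bigr (fun t : 'I_T => (E t (fun l => (traj l astar <= 2^-1)%R%:R))%:E)); last first.
  by move=> t _; exact: pE.
rewrite sumEFin -EFinD lee_fin.
have := regret_le r01 rstar gap_gt0 beta01 p0S T.
rewrite (mulrA 2 beta) => h; apply: le_trans h _; by rewrite [leRHS]addrC.
Qed.

(** * Almost sure convergence *)

Let x t w := p t w astar.
Let xE t w : x t w = traj (X t w) astar.
Proof. by rewrite /x samba_pE. Qed.

Lemma prob_mid_summable eps : 0 < eps <= 1 ->
  exists M : R, forall n, (\sum_(0 <= t < n) P [set w | eps <= x t w <= 1 - eps]%R <= M%:E)%E.
Proof.
move=> /andP[e0 e1].
pose k := beta * gap r astar * logsq (eps / #|A|%:R).
have N1 : 1 <= #|A|%:R :> R.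
  by rewrite -[leLHS]/(1%:R) ler_nat; apply/card_gt0P; exists astar.
have k0 : 0 < k.
  have /andP[c0 _] := betaDelta_itv r01 gap_gt0 beta01.
  rewrite mulr_gt0// logsq_gt0// divr_gt0//=; last lra.
  by rewrite ler_pdivrMr; lra.
exists k^-1 => n; rewrite big_mkord.
rewrite (eq_bigr (fun t : 'I_n => (E t (fun l => (mid astar beta p0 eps l)%:R))%:E)); last first.
  move=> t _; rewrite -(prob_pred_X t (mid astar beta p0 eps)).
  by congr (P _); apply/seteqP; split=> w /=; rewrite xE.
rewrite sumEFin lee_fin -[leRHS]mul1r ler_pdivlMr// mulrC.
exact: sum_mid_le.
Qed.

Lemma ae_not_mid eps : 0 < eps <= 1 ->
  {ae P, forall w, exists n : nat, forall t, (n <= t)%N -> ~~ (eps <= x t w <= 1 - eps)}.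
Proof.
move=> e01; have [M hM] := prob_mid_summable e01.
pose F t := [set w | eps <= x t w <= 1 - eps].
have mF t : measurable (F t).
  rewrite (_ : F t = [set w | mid astar beta p0 eps (X t w)]).
    exact: (@measurable_X t (fun l => mid astar beta p0 eps l)).
  by apply/seteqP; split=> w; rewrite /F /= xE.
have F0 : P (lim_sup_set F) = 0%E.
  apply: lim_sup_set_cvg0 => //; apply: le_lt_trans (ltry M).
  apply: lime_le; first by apply: is_cvg_nneseries => *; exact: measure_ge0.
  by apply: nearW => n; exact: hM.
exists (lim_sup_set F); split=> //.
  by apply: bigcapT_measurable => n; exact: bigcup_measurable.
move=> w /= hw n _; apply: contrapT => hn; apply: hw; exists n => t nt.
by apply/negP => ht; apply: hn; exists t.
Qed.

Let lo := low r astar.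

Lemma measurable_low_forever s :
  measurable [set w | forall t, (s <= t)%N -> x t w < lo].
Proof.
rewrite (_ : [set w | _] = \bigcap_(t in [set t | (s <= t)%N]) [set w | x t w < lo]); last first.
  by apply/seteqP; split=> w /=.
apply: bigcap_measurableType => t _.
rewrite (_ : [set w | _] = [set w | traj (X t w) astar < lo]).
  exact: (@measurable_X t (fun l => traj l astar < lo)).
by apply/seteqP; split=> w; rewrite /= xE.
Qed.

(** For each small [delta], the probability is at most [delta * (C + 1)]: [delta * C] from
    [Ex_stay_low], and another [delta] from a time at which intermediate mass is that unlikely. *)
Lemma prob_low_forever s : P [set w | forall t, (s <= t)%N -> x t w < lo] = 0%E.
Proof.
set F := [set w | _].
have mF : measurable F by exact: measurable_low_forever.
pose C := E s (fun l => (traj l astar)^-1).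
have C0 : 0 <= C.
  rewrite -(Ex_cst astar r01 beta01 p0S s 0); apply: le_Ex => // l _ lS.
  by rewrite invr_ge0; exact/ltW/lS.1.
have bound delta : 0 < delta <= 2^-1 -> (P F <= (delta * (C + 1))%:E)%E.
  move=> d01; have d1 : 0 < delta <= 1 by lra.
  have [M hM] := prob_mid_summable d1.
  pose m t := P [set w | delta <= x t w <= 1 - delta]%R.
  have [t st mt] : exists2 t, (s <= t)%N & (m t <= delta%:E)%E.
    (* Otherwise the probabilities from [s] on all exceed [delta], and more than [M / delta] of them
       break the bound [M] on their sum. *)
    apply: contrapT => hn.
    have hm t : (s <= t)%N -> (delta%:E <= m t)%E.
      by move=> st; rewrite leNgt; apply/negP => /ltW mt; apply: hn; exists t.
    pose n := (Num.truncn (M / delta)).+1.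
    have := hM (s + n)%N.
    rewrite (big_cat_nat _ (leq_addr n s))//=.
    have h1 : (0 <= \sum_(0 <= t < s) m t)%E by apply: sume_ge0 => *; exact: measure_ge0.
    have h2 : ((delta * n%:R)%:E <= \sum_(s <= t < s + n) m t)%E.
      rewrite (_ : (delta * n%:R)%:E = \sum_(s <= t < s + n) delta%:E)%E; last first.
        by rewrite sumEFin sumr_const_nat addKn mulr_natr.
      rewrite big_nat [X in (_ <= X)%E]big_nat; apply: lee_sum => t /andP[st _]; exact: hm.
    move=> h3; have := le_trans (leeD h1 h2) h3; rewrite add0e lee_fin.
    have : M / delta < n%:R by exact: truncnS_gt.
    by rewrite ltr_pdivrMr; lra.
  rewrite -(subnKC st) in mt; move: (t - s)%N mt => k mt.
  pose G l := low_since r astar beta p0 s l && (traj l astar < lo).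
  have FG : F `<=` [set w | G (X (s + k) w)].
    move=> w Fw; apply/andP; split; last by rewrite -xE; apply: Fw; exact: leq_addr.
    elim: (s + k)%N => [//|u ih]; apply/andP; split; first exact: ih.
    by rewrite size_X -xE; apply/implyP => /Fw.
  have mG : measurable [set w | G (X (s + k) w)].
    exact: (@measurable_X (s + k) (fun l => G l)).
  apply: le_trans (le_measure _ _ _ FG) _; rewrite ?inE//.
  rewrite [X in (X <= _)%E](prob_pred_X (s + k) G) lee_fin.
  apply: le_trans (Ex_stay_low r01 gap_gt0 beta01 p0S s k d01) _.
  rewrite mulrDr mulr1 lerD2l -lee_fin.
  rewrite -(prob_pred_X (s + k) (mid astar beta p0 delta)).
  apply: le_trans mt; rewrite le_eqVlt; apply/orP; left; apply/eqP.
  by congr (P _); apply/seteqP; split=> w; rewrite /= xE.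
apply/eqP; rewrite eq_le measure_ge0 andbT.
apply/lee_addgt0Pr => e e0; rewrite add0e.
pose delta := Num.min 2^-1 (e / (C + 1)).
have d0 : 0 < delta by rewrite lt_min invr_gt0 ltr0n divr_gt0//; lra.
have d2 : delta <= 2^-1 by rewrite /delta ge_min lexx.
have de : delta <= e / (C + 1) by rewrite /delta ge_min lexx orbT.
apply: le_trans (bound delta _) _; first by rewrite d0.
by rewrite lee_fin -ler_pdivlMr//; lra.
Qed.

Lemma ae_often_high :
  {ae P, forall w, forall s : nat, exists2 t, (s <= t)%N & lo <= x t w}.
Proof.
apply: ae_foralln => s.
exists [set w | forall t, (s <= t)%N -> x t w < lo]; split.
- exact: measurable_low_forever.
- exact: prob_low_forever.
- by move=> w /= hw t st; rewrite ltNge; apply/negP => ht; apply: hw; exists t.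
Qed.

Lemma ae_regular :
  {ae P, forall w, forall t : nat, x t w <= 1 /\ (2^-1 < x t w -> 2 * x t w - 1 <= x t.+1 w)}.
Proof.
apply: ae_foralln => t.
exists [set w | ~~ regular astar beta p0 (X t.+1 w)]; split.
- exact: (@measurable_X t.+1 (fun l => ~~ regular astar beta p0 l)).
- transitivity (E t.+1 (fun l => (~~ regular astar beta p0 l)%:R))%:E.
    exact: (prob_pred_X t.+1 (fun l => ~~ regular astar beta p0 l)).
  by rewrite Ex_irregular.
- move=> w; apply: contra_notP => /negP; rewrite negbK /= => /andP[h1 /implyP h2].
  by rewrite !xE; split.
Qed.

Lemma ae_cvg_star : {ae P, forall w, ((fun t : nat => x t w) @ \oo --> (1 : R))%classic}.
Proof.
(* Countably many levels, so that one null set serves them all; the shift by [3] keeps each level at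
   most [1/3]. *)
have e01 k : 0 < (k.+3%:R^-1 : R) <= 1.
  by rewrite invr_gt0 ltr0n/= invf_le1 ?ltr0n// -[leLHS]/(1%:R) ler_nat.
have hmid := ae_foralln (fun k => ae_not_mid (e01 k)).
apply: filterS3 ae_regular hmid ae_often_high => w hreg {}hmid hhigh.
apply/cvgrPdist_lt => e e0.
have lo0 : 0 < lo by exact: low_gt0.
pose k := Num.truncn (e^-1 + lo^-1).
have ek : e^-1 + lo^-1 < k.+3%:R.
  by apply: lt_le_trans (truncnS_gt _) _; rewrite ler_nat; exact/leqW/leqnSn.
pose eps : R := k.+3%:R^-1.
have eps0 : 0 < eps by rewrite invr_gt0 ltr0n.
have eps_lt (y : R) : 0 < y -> y^-1 < k.+3%:R -> eps < y.
  by move=> y0 yk; rewrite /eps invf_plt ?posrE ?ltr0n.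
have eps_e : eps < e.
  by apply: eps_lt => //; apply: le_lt_trans ek; rewrite lerDl invr_ge0 ltW.
have eps_lo : eps < lo.
  by apply: eps_lt => //; apply: le_lt_trans ek; rewrite lerDr invr_ge0 ltW.
have eps3 : eps <= 3^-1.
  by rewrite /eps lef_pV2 ?posrE ?ltr0n// ler_nat.
have [n hn] := hmid k; have [t1 nt1 ht1] := hhigh n.
(* At [t1] the mass is at least [lo > eps] and not intermediate, hence above [1 - eps]. Afterwards
   one step leaves it above [1 - 2 * eps >= eps], so avoiding the middle forces it above [1 - eps]
   again. *)
have high t : (t1 <= t)%N -> 1 - eps < x t w.
  move=> /subnKC <-; elim: (t - t1)%N => [|m ih].
    rewrite addn0; have := hn t1 nt1; rewrite negb_and -!ltNge -/eps => /orP[|//].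
    lra.
  rewrite addnS; have [_ jump] := hreg (t1 + m)%N.
  have {}jump : 2 * x (t1 + m)%N w - 1 <= x (t1 + m).+1 w by apply: jump; lra.
  have := hn (t1 + m).+1 (leqW (leq_trans nt1 (leq_addr _ _))).
  rewrite negb_and -!ltNge -/eps => /orP[|//]; lra.
exists t1 => // t /= t1t; have [xle _] := hreg t.
by rewrite ger0_norm ?subr_ge0//; have := high t t1t; lra.
Qed.

End Process.

Theorem theorem2 (R : realType) (A : finType) (d : measure_display)
  (Omega : measurableType d) (P : probability Omega R)
  (r : A -> R) (astar : A) (p0 : A -> R) (beta : R)
  (L I : nat -> Omega -> A) (Rw : A -> nat -> Omega -> bool) :
  (* bandit *)
  (forall a, 0 <= r a <= 1) ->
  (forall a, a != astar -> r a < r astar) ->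
  0 < gap r astar ->
  (* initial probability vector, all entries positive *)
  (forall a, 0 < p0 a) -> \sum_(a : A) p0 a = 1 ->
  (* learning rate parameter *)
  0 < beta <= 1 ->
  (* leader, played arm and rewards are random variables *)
  (forall t a, measurable [set w | L t w = a]) ->
  (forall t a, measurable [set w | I t w = a]) ->
  (forall a t, measurable [set w | Rw a t w]) ->
  (* joint law: given the past, the leader is uniform on the argmax of p(t),
     arm a is played with probability p_a(t), and the rewards R_c(t) are
     independent Bernoulli(r c), independent of everything else *)
  (forall (t : nat) (h : nat -> obs A),
     P (hist_event L I Rw t.+1 h) =
     (P (hist_event L I Rw t h) *
      (step_prob r (samba_traj (samba_alpha beta) p0 h t) (h t))%:E)%E) ->
  let p := samba_p L I Rw (samba_alpha beta) p0 in
  (* (i) Markov property *)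
  (forall (t : nat) (x : nat -> (A -> R)),
     (P ([set w | forall s, (s <= t.+1)%N -> p s w = x s]) *
      P ([set w | p t w = x t]))%E =
     (P ([set w | forall s, (s <= t)%N -> p s w = x s]) *
      P ([set w | p t w = x t /\ p t.+1 w = x t.+1]))%E) /\
  (* (ii) almost sure convergence of p_{a_star}(t) to 1 *)
  {ae P, forall w, ((fun t : nat => p t w astar : R) @ \oo --> (1 : R))%classic} /\
  (* (iii) regret bound *)
  (forall T : nat,
     ((r astar * T%:R)%:E - \int[P]_w (total_reward R I Rw T w)%:E <=
      (#|A|%:R / (2 * beta * gap r astar) * (ln (beta * gap r astar * T%:R)) ^+ 2)%:E
      + (\sum_(0 <= t <oo) P [set w | (p t w astar <= 2^-1)%R])
      + ((Num.ceil (expR 1 / (beta * gap r astar)))%:~R)%:E)%E).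
Proof.
move=> r01 rstar gap0 p00 p01 beta01 mL mI mR law p.
have p0S : simplex p0 by [].
split; first exact: markov_property.
by split; [exact: ae_cvg_star|exact: regret_bound].
Qed.
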